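(* Let $K$ be a positive-definite even lattice, $k$ a positive integer, $L=K\oplus\cdots\oplus K$ the orthogonal direct sum of $k$ copies of $K$, $\nu$ the isometry $(\alpha_1,\dots,\alpha_k)\mapsto(\alpha_2,\dots,\alpha_k,\alpha_1)$ of $L$, and $\hat\nu$ the corresponding cyclic permutation automorphism of $V_L=V_K^{\otimes k}$. Let $(V_L^T,Y^{\hat\nu})$ and $(V_K,Y_{\hat\nu})$ be the $\hat\nu$-twisted $V_K^{\otimes k}$-modules defined in the context, and let $\mathcal{F}:V_L^T\to V_K$ be the normalized isomorphism of $\hat\nu$-twisted $V_K^{\otimes k}$-modules, i.e. the linear isomorphism with $$Y_{\hat\nu}(u,x)\mathcal{F}(v)=\mathcal{F}(Y^{\hat\nu}(u,x)v)\quad\text{for all }u\in V_L=V_K^{\otimes k},\ v\in V_L^T,$$ and $\mathcal{F}(\mathbf 1)=\mathbf 1$. Then $\mathcal{F}$ is the unique linear map from $V_L^T$ to $V_K$ such that $$\mathcal{F}\circ(\alpha,0,\dots,0)^T(x)\circ\mathcal{F}^{-1}=\frac1k\,x^{1/k-1}\,\alpha(x^{1/k})\qquad\text{for all }\alpha\in K,$$ and such that $\mathcal{F}$ on the group algebra component $U_T\simeq\mathbb{C}[P_0L]$ of $V_L^T$ is the isomorphism $\mathbb{C}[P_0L]\simeq\mathbb{C}[K]$ given by extension of the isomorphism $P_0L\simeq K$, $\frac1k(\alpha,\alpha,\dots,\alpha)\mapsto\alpha$. Furthermore, for all $(\alpha_1,\dots,\alpha_k)\in L$, $$\mathcal{F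}\circ(\alpha_1,\dots,\alpha_k)^T(x)\circ\mathcal{F}^{-1}=\frac1k\,x^{1/k-1}\sum_{j=1}^k\eta^{j-1}\alpha_j(\eta^{j-1}x^{1/k}).$$
   Context: **Vertex operator algebras and twisted modules.** $\delta(x)=\sum_{n\in\mathbb{Z}}x^n$; binomials $(x_1-x_2)^n$ are expanded in nonnegative integral powers of the second variable. A vertex operator algebra $(V,Y,\mathbf 1,\omega)$ is a $\mathbb{Z}$-graded complex vector space $V=\coprod V_n$ with $\dim V_n<\infty$, $V_n=0$ for $n\ll0$, a linear map $v\mapsto Y(v,x)=\sum_{n\in\mathbb{Z}} v_nx^{-n-1}\in(\mathrm{End}\,V)[[x,x^{-1}]]$, a vacuum $\mathbf 1\in V_0$ and conformal element $\omega\in V_2$, satisfying truncation, vacuum and creation axioms, the Jacobi identity, the Virasoro relations with central charge $c$ for $L(n)=\omega_{n+1}$, $L(0)v=nv$ for $v\in V_n$, and $\frac{d}{dx}Y(v,x)=Y(L(-1)v,x)$. An automorphism $g$ of $V$ is a linear automorphism fixing $\mathbf 1,\omega$ with $gY(v,x)g^{-1}=Y(gv,x)$. Fix a primitive $k$-th root of unity $\eta$. If $g^k=1$, let $V^j=\{v: gv=\eta^jv\}$. A $g$-twisted $V$-module is a $\mathbb{C}$-graded space $M=\coprod_{\lambda\in\mathbb{C}}M_\lambda$ with $\dim M_\lambda<\infty$ and $M_{n/k+\lambda}=0$ for all sufficiently negative integers $n$, with a linear map $v\mapsto Y^g(v,x)=\sum_{n\in\frac1k\mathbb{Z}}v_n^gx^{-n-1}\in(\mathrm{End}\,M)[[x^{1/k},x^{-1/k}]]$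 such that: $Y^g(v,x)=\sum_{n\in j/k+\mathbb{Z}}v^g_nx^{-n-1}$ for $v\in V^j$; $v_n^gw=0$ for $n$ large; $Y^g(\mathbf 1,x)=1$; $$x_0^{-1}\delta\Big(\tfrac{x_1-x_2}{x_0}\Big)Y^g(u,x_1)Y^g(v,x_2)-x_0^{-1}\delta\Big(\tfrac{x_2-x_1}{-x_0}\Big)Y^g(v,x_2)Y^g(u,x_1)=x_2^{-1}\frac1k\sum_{j\in\mathbb{Z}/k\mathbb{Z}}\delta\Big(\eta^j\tfrac{(x_1-x_0)^{1/k}}{x_2^{1/k}}\Big)Y^g(Y(g^ju,x_0)v,x_2);$$ the operators $L^g(n)=\omega^g_{n+1}$ satisfy the Virasoro relations with central charge $c$; $L^g(0)w=\lambda w$ for $w\in M_\lambda$; $\frac{d}{dx}Y^g(v,x)=Y^g(L(-1)v,x)$. For $g=1$ this is the notion of $V$-module. A homomorphism of $g$-twisted modules is a linear map $f$ with $f(Y_1^g(v,x)w)=Y_2^g(v,x)f(w)$ for all $v\in V$ and all $w$. **Lattice vertex operator algebras.** Put $\eta_0=(-1)^k\eta$. For a positive-definite even lattice $Q$ (here $Q=K$ or $L$), let $1\to\langle\eta_0\rangle\to\hat Q\to Q\to1$ ($a\mapsto\bar a$) be the central extension with commutator map $C_0(\alpha,\beta)=(-1)^{\langle\alpha,\beta\rangle}$. Let $\mathfrak h_Q=\mathbb{C}\otimes_{\mathbb{Z}}Q$, $\hat{\mathfrak h}_Q=\mathfrak h_Q\otimes\mathbb{C}[t,t^{-1}]\oplus\mathbb{C}\mathbf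 c$ with $[\alpha\otimes t^m,\beta\otimes t^n]=\langle\alpha,\beta\rangle m\delta_{m+n,0}\mathbf c$ and $\mathbf c$ central, $M(1)$ the induced module from $\mathbb{C}$ with $\mathfrak h_Q\otimes\mathbb{C}[t]$ acting as $0$ and $\mathbf c$ as $1$; $\mathbb{C}\{Q\}=\mathbb{C}[\hat Q]\otimes_{\mathbb{C}[\langle\eta_0\rangle]}\mathbb{C}$ ($\eta_0$ acting on $\mathbb{C}$ by multiplication), $\iota(a)$ the image of $a$ in $\mathbb{C}\{Q\}$, $a\cdot\iota(b)=\iota(ab)$, $h\cdot\iota(a)=\langle h,\bar a\rangle\iota(a)$, $x^h\cdot\iota(a)=x^{\langle h,\bar a\rangle}\iota(a)$. Then $V_Q=M(1)\otimes\mathbb{C}\{Q\}$. Write $\alpha(n)$ for the action of $\alpha\otimes t^n$, $\alpha(x)=\sum_n\alpha(n)x^{-n-1}$. For $a\in\hat Q$, $Y(a,x)={}_\circ^\circ e^{\int(\bar a(x)-\bar a(0)x^{-1})}a\,x^{\bar a}{}_\circ^\circ$, and for $v=\alpha_1(-n_1)\cdots\alpha_m(-n_m)\iota(a)$, $Y(v,x)={}_\circ^\circ\prod_i\big(\frac1{(n_i-1)!}(\frac d{dx})^{n_i-1}\alpha_i(x)\big)Y(a,x){}_\circ^\circ$, where normal ordering places $\alpha(n)$ ($n<0$) and $a\in\hat Q$ to the left of $\alpha(n)$ ($n\ge0$) and $x^\alpha$, and integration is the termwise formal integration. $\mathbf 1=1\otimes\iota(1)$, $\omega=\frac12\sum_ih_i(-1)h_i(-1)\mathbf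 1$ for an orthonormal basis $\{h_i\}$ of $\mathfrak h_Q$. **Setting.** $\langle(\alpha_i),(\beta_i)\rangle=\sum_i\langle\alpha_i,\beta_i\rangle$ on $L$; $\mathfrak h=\mathbb{C}\otimes_{\mathbb{Z}}L$. One takes $\hat L$ to be the quotient of $\hat K^k$ identifying the $k$ copies of $\langle\eta_0\rangle$, so that $V_L=V_K^{\otimes k}$ (with $\iota(a_1\cdots a_k)=\iota(a_1)\otimes\cdots\otimes\iota(a_k)$, $a_i$ in the $i$-th factor). The isometry $\nu$ lifts to the automorphism $\hat\nu$ of $\hat L$ permuting the factors; the induced automorphism $\hat\nu$ of $V_L$ is $v_1\otimes\cdots\otimes v_k\mapsto v_2\otimes\cdots\otimes v_k\otimes v_1$. One has $\hat\nu a=a$ when $\nu\bar a=\bar a$. For $v\in V_K$, $v^1=v\otimes\mathbf 1\otimes\cdots\otimes\mathbf 1$ and $v^{j+1}=\hat\nu^{-j}(v^1)$. **The module $(V_L^T,Y^{\hat\nu})$.** Let $1\to\langle\eta_0\rangle\to\hat L_\nu\to L\to1$ be the central extension with commutator map $C(\alpha,\beta)=\prod_{j=0}^{k-1}(-\eta^j)^{\langle\nu^j\alpha,\beta\rangle}$, identified with $\hat L$ as a set so that the products are related by $a\times b=\prod_{0<j<k/2}(-\eta^j)^{\langle\nu^{-j}\bar a,\bar b\rangle}\,a\times_\nu b$; $\hat\nu$ is also an automorphism of $\hat L_\nu$. For $n\in\mathbb{Z}$ let $\mathfrak h_{(n)}=\{h\in\mathfrak h:\nu h=\eta^nh\}$,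 $h_{(n)}$ the projection of $h$ to $\mathfrak h_{(n)}$ along the other eigenspaces, and $P_0$ the projection to $\mathfrak h_{(0)}$; thus $P_0L=\{\frac1k(\alpha,\dots,\alpha):\alpha\in K\}$. Let $\hat{\mathfrak h}[\nu]=\coprod_{n\in\frac1k\mathbb{Z}}\mathfrak h_{(kn)}\otimes t^n\oplus\mathbb{C}\mathbf c$ with brackets $[\alpha\otimes t^m,\beta\otimes t^n]=\langle\alpha,\beta\rangle m\delta_{m+n,0}\mathbf c$, $\mathbf c$ central, and $S[\nu]=U(\hat{\mathfrak h}[\nu])\otimes_{U(\coprod_{n\ge0}\mathfrak h_{(kn)}\otimes t^n\oplus\mathbb{C}\mathbf c)}\mathbb{C}$ with $\coprod_{n\ge0}\mathfrak h_{(kn)}\otimes t^n$ acting as $0$ and $\mathbf c$ as $1$ on $\mathbb{C}$. Let $N=\{\alpha\in L:\langle\alpha,\mathfrak h_{(0)}\rangle=0\}=(1-\nu)L$ and $\hat N$ its preimage in $\hat L_\nu$ (an abelian group). Let $\tau:\hat N\to\mathbb{C}^\times$ be the unique homomorphism with $\tau(\eta_0)=\eta_0$ and $\tau(a\,\hat\nu a^{-1})=\eta^{-\sum_{j=0}^{k-1}\langle\nu^j\bar a,\bar a\rangle/2}$ for $a\in\hat L_\nu$, $T=\mathbb{C}_\tau$ the corresponding one-dimensional $\hat N$-module, $U_T=\mathbb{C}[\hat L_\nu]\otimes_{\mathbb{C}[\hat N]}T$, with $a\cdot(b\otimes r)=ab\otimes r$, $h\cdot(b\otimes r)=\langle h,\bar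 b\rangle b\otimes r$ and $x^h\cdot(b\otimes r)=x^{\langle h,\bar b\rangle}b\otimes r$ for $h\in\mathfrak h_{(0)}$. Set $V_L^T=S[\nu]\otimes U_T$, with $\hat{\mathfrak h}[\nu]$-elements of nonzero degree and $\mathbf c$ acting on $S[\nu]$, and $\hat L_\nu$, $\mathfrak h_{(0)}=\mathfrak h_{(0)}\otimes t^0$ and $x^h$ acting on $U_T$; $\mathbf 1\in V_L^T$ denotes $1\otimes(1\otimes1)$. For $\alpha\in\mathfrak h$, $n\in\frac1k\mathbb{Z}$, $\alpha^T(n)$ is the operator of $\alpha_{(kn)}\otimes t^n$ and $\alpha^T(x)=\sum_{n\in\frac1k\mathbb{Z}}\alpha^T(n)x^{-n-1}$. Let $\sigma(\alpha)=\prod_{0<j<k/2}(1-\eta^{-j})^{\langle\nu^j\alpha,\alpha\rangle}$, multiplied by $2^{\langle\nu^{k/2}\alpha,\alpha\rangle/2}$ when $k$ is even. For $a\in\hat L$ (viewed in $\hat L_\nu$), $$Y^{\hat\nu}(a,x)=k^{-\langle\bar a,\bar a\rangle/2}\sigma(\bar a)\,{}_\circ^\circ e^{\int(\bar a^T(x)-\bar a^T(0)x^{-1})}a\,x^{\bar a_{(0)}+\langle\bar a_{(0)},\bar a_{(0)}\rangle/2-\langle\bar a,\bar a\rangle/2}{}_\circ^\circ,$$ and for $v=\alpha_1(-n_1)\cdots\alpha_m(-n_m)\iota(a)\in V_L$, $W(v,x)={}_\circ^\circ\prod_i\big(\frac1{(n_i-1)!}(\frac d{dx})^{n_i-1}\alpha_i^T(x)\big)Y^{\hat\nu}(a,x){}_\circ^\circ$,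 extended linearly (normal ordering as before, applied to the operators $\alpha^T(n)$). Define $c_{mnr}$ by $$\sum_{m,n\ge0}c_{mn0}x^my^n=-\tfrac12\sum_{j=1}^{k-1}\log\tfrac{(1+x)^{1/k}-\eta^{-j}(1+y)^{1/k}}{1-\eta^{-j}},\quad \sum_{m,n\ge0}c_{mnr}x^my^n=\tfrac12\log\tfrac{(1+x)^{1/k}-\eta^{-r}(1+y)^{1/k}}{1-\eta^{-r}}\ (1\le r\le k-1),$$ and $\Delta_x=\sum_{m,n\ge0}\sum_{r=0}^{k-1}\sum_jc_{mnr}(\nu^{-r}\beta_j)(m)\beta_j(n)x^{-m-n}$ for an orthonormal basis $\{\beta_j\}$ of $\mathfrak h$. Finally $Y^{\hat\nu}(v,x)=W(e^{\Delta_x}v,x)$ for $v\in V_L$. It is known (Lepowsky; Frenkel–Lepowsky–Meurman; Dong–Lepowsky) that $(V_L^T,Y^{\hat\nu})$ is an irreducible $\hat\nu$-twisted $V_L$-module. **The module $(V_K,Y_{\hat\nu})$.** Let $a_j\in\mathbb{C}$ ($j\ge1$) be determined by $\exp\big(-\sum_{j\ge1}a_jx^{j+1}\frac{\partial}{\partial x}\big)\cdot x=\frac1k(1+x)^k-\frac1k$. With $L(j)$ the Virasoro operators of $V_K$, $$\mathcal{E}_f(x^{1/k})=\exp\Big(\sum_{j\ge1}a_jx^{-j/k}L(j)\Big)k^{-L(0)}x^{(1/k-1)L(0)}.$$ On the space $V_K$, with $Y$ the vertex operator map of $V_K$, define for $u\in V_K$ $$Y_{\hat\nu}(u^1,x)=Y(\mathcal{E}_f(x^{1/k})u,x^{1/k}),\qquad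 Y_{\hat\nu}(u^{j+1},x)=\lim_{x^{1/k}\to\eta^jx^{1/k}}Y_{\hat\nu}(u^1,x)$$ (the limit is formal substitution). By a theorem of Barron–Dong–Mason, since the $u^j$ generate $V_K^{\otimes k}$, these determine operators $Y_{\hat\nu}(v,x)$ for all $v\in V_K^{\otimes k}$ making $(V_K,Y_{\hat\nu})$ an irreducible $\hat\nu$-twisted $V_K^{\otimes k}$-module. The twisted modules $(V_L^T,Y^{\hat\nu})$ and $(V_K,Y_{\hat\nu})$ are isomorphic, by an isomorphism unique up to a nonzero scalar. **Group algebra identifications.** Choose a section $\alpha\mapsto e_\alpha$ of $\hat K\to K$ with $e_0=1$, and let $e_{(\alpha,0,\dots,0)}\in\hat L$ be $e_\alpha$ placed in the first factor (so $\iota(e_{(\alpha,0,\dots,0)})=\iota(e_\alpha)^1$ in $V_L=V_K^{\otimes k}$), also viewed as an element of $\hat L_\nu$. Then $\mathbb{C}[K]\simeq\mathbb{C}\{K\}\subset V_K$ via $e^\alpha\leftrightarrow\iota(e_\alpha)$, and $\mathbb{C}[P_0L]\simeq U_T=1\otimes U_T\subset V_L^T$ via $e^{\frac1k(\alpha,\dots,\alpha)}\leftrightarrow e_{(\alpha,0,\dots,0)}\otimes1$, for $\alpha\in K$. Under these identifications the isomorphism of group algebra components in the claim sends $e_{(\alpha,0,\dots,0)}\otimes1\mapsto\iota(e_\alpha)$. *)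

(* Defs.v *)
From HB Require Import structures.
From mathcomp Require Import all_boot all_order all_algebra.
From mathcomp Require Import finmap multiset.
From mathcomp Require Import boolp classical_sets functions fsbigop reals.
From mathcomp Require Import complex monalg ring zify.

Set Implicit Arguments.
Unset Strict Implicit.
Unset Printing Implicit Defensive.

Import Order.TTheory GRing.Theory Num.Theory.
Local Open Scope classical_set_scope.
Local Open Scope ring_scope.

(* An element of (End M)[[x^{1/k}, x^{-1/k}]] is represented by the family of
   its coefficients: [f q] is the coefficient of x^{q/k}.  All infinite sums
   below have finite support when evaluated at a vector, and are written with
   the finitely supported sums [\sum_(i \in [set: T])] of fsbigop. *)
Section Series.
Variables (C : numClosedFieldType) (M : lmodType C).

Definition series := int -> M -> M.

Implicit Types f g : series.

Definition sadd f g : series := fun q w => f q w + g q w.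
Definition sscale (c : C) f : series := fun q w => c *: f q w.
Definition sconst (e : M -> M) : series := fun q w => if q == 0 then e w else 0.
Definition smul f g : series :=
  fun q w => \sum_(p \in [set: int]) f p (g (q - p) w).
Definition spow f (n : nat) : series := iter n (smul f) (sconst id).
Definition sexp f : series :=
  fun q w => \sum_(n \in [set: nat]) (n`!%:R)^-1 *: spow f n q w.

(* multiplication by x^{e/k} *)
Definition sshift (e : int) f : series := fun q w => f (q - e) w.

(* the substitution x^{1/k} -> c x^{1/k} *)
Definition ssubst (c : C) f : series := fun q w => c ^ q *: f q w.

(* d/dx, and termwise integration (applied to series without x^{-1} term) *)
Definition sder (k : nat) f : series :=
  fun q w => ((q + k%:Z)%:~R / k%:R) *: f (q + k%:Z) w.
Definition sint (k : nat) f : series :=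
  fun q w => (q%:~R / k%:R)^-1 *: f (q - k%:Z) w.

End Series.

(* Y(e(x)v, x) for a vertex operator map Y (with [Y v q] the coefficient of
   x^{q/k}) and a series e in End V whose [p]-th coefficient goes with
   x^{s p/k}. *)
Definition insert_series (C : numClosedFieldType) (V M : lmodType C) (s : int)
    (e : series V) (Y : V -> series M) (v : V) : series M :=
  fun q w => \sum_(p \in [set: int]) Y (e p v) (q - s * p) w.

(* x(x-1)...(x-i+1)/i! *)
Definition gbinom (C : numClosedFieldType) (x : C) (i : nat) : C :=
  (\prod_(l < i) (x - l%:R)) / i`!%:R.

Section TwistedModule.
Variables (C : numClosedFieldType) (V : lmodType C) (Y : V -> series V).
Variables (vac omega : V) (c : C).
Variables (g : V -> V) (k : nat) (eta : C).
Variables (M : lmodType C) (Yg : V -> series M).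

(* u_n, where Y(u,x) = \sum_n u_n x^{-n-1} *)
Definition vmode (u : V) (n : int) : V -> V := Y u (- n - 1).

(* L^g(n) = omega^g_{n+1} *)
Definition Lg (n : int) : M -> M := Yg omega (k%:Z * (- n - 2%:Z)).

(* The Jacobi identity applied to w: coefficient of
   x_0^{-n-1} x_1^{q/k} x_2^{r/k} on both sides. *)
Definition twisted_jacobi : Prop :=
  forall (u v : V) (w : M) (n q r : int),
    \sum_(i \in [set: nat]) (gbinom n%:~R i * (-1) ^+ i) *:
        Yg u (q - k%:Z * (n - i%:Z)) (Yg v (r - k%:Z * i%:Z) w)
    - \sum_(i \in [set: nat]) ((-1) ^ n * gbinom n%:~R i * (-1) ^+ i) *:
        Yg v (r - k%:Z * (n - i%:Z)) (Yg u (q - k%:Z * i%:Z) w)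
    = k%:R^-1 *: \sum_(j < k) \sum_(i \in [set: nat])
        (eta ^ (j%:Z * (q + k%:Z * i%:Z))
           * gbinom (q%:~R / k%:R + i%:R) i * (-1) ^+ i) *:
        Yg (vmode (iter j g u) (n + i%:Z) v) (r + q + k%:Z * (i%:Z + 1)) w.

(* M = \coprod_\lambda M_\lambda *)
Definition is_grading (gr : C -> M -> Prop) : Prop :=
  [/\ forall l, gr l 0,
      forall l (a : C) u v, gr l u -> gr l v -> gr l (a *: u + v),
      forall w, exists (s : seq C) (f : C -> M),
        (forall l, gr l (f l)) /\ w = \sum_(l <- s) f l
    & forall (s : seq C) (f : C -> M), uniq s -> (forall l, gr l (f l)) ->
        \sum_(l <- s) f l = 0 -> forall l, l \in s -> f l = 0].

Definition fin_dim (W : M -> Prop) : Prop :=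
  exists (n : nat) (b : 'I_n -> M), forall w, W w ->
    exists a : 'I_n -> C, w = \sum_i a i *: b i.

Record twisted_module : Prop := TwistedModule {
  tm_linl : forall (a : C) u v q w,
    Yg (a *: u + v) q w = a *: Yg u q w + Yg v q w;
  tm_linr : forall v q (a : C) w w',
    Yg v q (a *: w + w') = a *: Yg v q w + Yg v q w';
  tm_grading : exists gr : C -> M -> Prop,
    [/\ is_grading gr,
        forall l, fin_dim (gr l),
        forall l, exists N : int, forall n : int, n < N ->
          forall w, gr (n%:~R / k%:R + l) w -> w = 0
      & forall l w, gr l w -> Lg 0 w = l *: w];
  (* Y^g(v,x) has only the powers x^{-n-1}, n in j/k + Z, for v in V^j *)
  tm_eigen : forall (j : nat) v, g v = eta ^+ j *: v ->
    forall q : int, ~~ (k%:Z %| q + j%:Z)%Z -> forall w, Yg v q w = 0;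
  tm_trunc : forall v w, exists N : int, forall q : int, q < N -> Yg v q w = 0;
  tm_vac : forall q w, Yg vac q w = if q == 0 then w else 0;
  tm_jacobi : twisted_jacobi;
  tm_virasoro : forall (m n : int) w,
    Lg m (Lg n w) - Lg n (Lg m w) =
      (m - n)%:~R *: Lg (m + n) w
      + (if m + n == 0 then ((m ^+ 3 - m)%:~R / 12%:R) * c else 0) *: w;
  tm_deriv : forall v q w,
    sder k (Yg v) q w = Yg (vmode omega 0 v) q w   (* L(-1) = omega_0 *)
}.

End TwistedModule.

Definition twisted_hom (C : numClosedFieldType) (V M1 M2 : lmodType C)
    (Y1 : V -> series M1) (Y2 : V -> series M2) (f : M1 -> M2) : Prop :=
  forall v q w, f (Y1 v q w) = Y2 v q (f w).

(* [fock C J P] has basis the pairs (A, p) of a monomial (finite multiset) A in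
   the variables (j, m) : J * nat and an element p of P.  It realizes
   S \otimes C[P] for the module S over a Heisenberg algebra induced from its
   nonnegative part: by PBW, S is the polynomial algebra on a basis of the
   negative part, where (j, m) is the j-th vector of the basis of the
   (m+1)-st negative degree. *)
Definition monomial (J : finType) (P : choiceType) : choiceType :=
  ({mset (J * nat)%type}%mset * P)%type.

Definition fock (C : numClosedFieldType) (J : finType) (P : choiceType) :=
  {malg C[monomial J P]}.

(* The operations of the free module [{malg C[_]}] are locked, to keep
   unification from unfolding them. *)
HB.lock Definition fock0 (C : numClosedFieldType) (J : finType)
    (P : choiceType) : fock C J P := 0.
HB.lock Definition fock_opp (C : numClosedFieldType) (J : finType)
    (P : choiceType) (u : fock C J P) : fock C J P := - u.
HB.lock Definition fock_add (C : numClosedFieldType) (J : finType)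
    (P : choiceType) (u v : fock C J P) : fock C J P := u + v.
HB.lock Definition fock_scale (C : numClosedFieldType) (J : finType)
    (P : choiceType) (a : C) (u : fock C J P) : fock C J P :=
  (a : (C : nzRingType)) *: u.

HB.lock Definition bas (C : numClosedFieldType) (J : finType)
    (P : choiceType) (b : monomial J P) : fock C J P := mkmalgU b 1.

(* the linear map with values f(b) on the basis *)
HB.lock Definition lext (C : numClosedFieldType) (J : finType)
    (P : choiceType) (M : lmodType C) (f : monomial J P -> M)
    (v : fock C J P) : M :=
  \sum_(b <- msupp v) mcoeff b v *: f b.

Section Fock.
Variables (C : numClosedFieldType) (J : finType) (P : choiceType).
Local Notation fock := (@fock C J P).
Local Notation monomial := (monomial J P).
Local Notation bas := (@bas C J P).

HB.instance Definition _ := Choice.on fock.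

Let addA : associative (@fock_add C J P).
Proof. by move=> u v w; rewrite unlock addrA. Qed.
Let addC : commutative (@fock_add C J P).
Proof. by move=> u v; rewrite unlock addrC. Qed.
Let add0 : left_id (fock0 C J P) (@fock_add C J P).
Proof. by move=> u; rewrite !unlock add0r. Qed.
Let addN : left_inverse (fock0 C J P) (@fock_opp C J P) (@fock_add C J P).
Proof. by move=> u; rewrite !unlock addNr. Qed.
HB.instance Definition _ := GRing.isZmodule.Build fock addA addC add0 addN.

Let scaleA a b v :
  @fock_scale C J P a (fock_scale b v) = fock_scale (a * b) v.
Proof. by rewrite unlock; apply: scalerA. Qed.
Let scale1 : left_id 1 (@fock_scale C J P).
Proof. by move=> v; rewrite unlock; apply: scale1r. Qed.
Let scaleDr : right_distributive (@fock_scale C J P) +%R.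
Proof.
by move=> a u v; rewrite /GRing.add /= !unlock; apply: scalerDr.
Qed.
Let scaleDl v : {morph (@fock_scale C J P)^~ v : a b / a + b}.
Proof.
by move=> a b; rewrite [in RHS]/GRing.add /= !unlock; apply: scalerDl.
Qed.
HB.instance Definition _ := GRing.Zmodule_isLmodule.Build C fock
  scaleA scale1 scaleDr scaleDl.

Let M0 := {malg C[monomial]}.
Let mcoeffE (a : C) (u v : fock) b :
  mcoeff b (a *: u + v) = a * mcoeff b (u : M0) + mcoeff b (v : M0).
Proof.
have -> : a *: u + v = fock_add (fock_scale a u) v by [].
by rewrite fock_add.unlock fock_scale.unlock [LHS]mcoeffD mcoeffZ.
Qed.

Lemma lext_is_linear (M : lmodType C) (f : monomial -> M) :
  linear (lext f : fock -> M).
Proof.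
have lextEw (D : {fset monomial}) v : (msupp v `<=` D)%fset ->
    lext f v = \sum_(b <- D) mcoeff b v *: f b.
  move=> le; rewrite unlock (big_fset_incl _ le) //= => b _ /mcoeff_outdom ->.
  by rewrite scale0r.
move=> a u v.
pose D := (msupp u `|` msupp v `|` msupp (a *: u + v))%fset.
have lew : (msupp (a *: u + v) `<=` D)%fset by rewrite fsubsetUr.
have leu : (msupp u `<=` D)%fset by rewrite -[D]fsetUA fsubsetUl.
have lev : (msupp v `<=` D)%fset by rewrite /D fsetUAC fsubsetUr.
rewrite !(lextEw D) // scaler_sumr -big_split /=.
by apply: eq_bigr => b _; rewrite mcoeffE scalerDl scalerA.
Qed.

HB.instance Definition _ (M : lmodType C) (f : monomial -> M) :=
  GRing.isLinear.Build C fock M *:%R (lext f) (lext_is_linear f).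

Lemma lext_bas (M : lmodType C) (f : monomial -> M) b : lext f (bas b) = f b.
Proof.
by rewrite lext.unlock bas.unlock msuppU oner_eq0 big_seq_fset1 mcoeffUU scale1r.
Qed.

(* multiplication by \sum_j c_j X_(j,m) *)
Definition creation (c : J -> C) (m : nat) : fock -> fock :=
  lext (fun b => \sum_j c j *: bas (((j, m) +` b.1)%mset, b.2)).

(* the derivation \sum_j c_j d/dX_(j,m) *)
Definition annihilation (c : J -> C) (m : nat) : fock -> fock :=
  lext (fun b => \sum_j (c j * (b.1 (j, m))%:R) *: bas ((b.1 `\ (j, m))%mset, b.2)).

Lemma fock_ind (M : lmodType C) (f g : {linear fock -> M}) :
  (forall b, f (bas b) = g (bas b)) -> f =1 g.
Proof.
move=> fg v; have -> : v = lext bas v.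
  rewrite lext.unlock; apply/malgP => b'.
  have m0 : mcoeff b' (0 : fock) = 0.
    have -> : 0 = fock0 C J P by [].
    by rewrite fock0.unlock; apply: mcoeff0.
  have mD (u w : fock) : mcoeff b' (u + w) = mcoeff b' u + mcoeff b' w.
    by have := mcoeffE 1 u w b'; rewrite scale1r mul1r.
  have mZ a (u : fock) : mcoeff b' (a *: u) = a * mcoeff b' u.
    by have := mcoeffE a u 0 b'; rewrite !addr0 m0 addr0.
  rewrite (big_morph _ mD m0) {1}[v]monalgE raddf_sum.
  apply: eq_bigr => b _; rewrite [LHS]mcoeffU mZ bas.unlock.
  by rewrite (mcoeffU b 1) mulrnAr mulr1.
rewrite lext.unlock !linear_sum; apply: eq_bigr => b _.
by rewrite !linearZ_LR fg.
Qed.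

HB.instance Definition _ (c : J -> C) m := GRing.Linear.on (creation c m).
HB.instance Definition _ (c : J -> C) m := GRing.Linear.on (annihilation c m).

Lemma creation_bas (c : J -> C) m b : creation c m (bas b) =
  \sum_j c j *: bas (((j, m) +` b.1)%mset, b.2).
Proof. exact: lext_bas. Qed.

Lemma annihilation_bas (c : J -> C) m b : annihilation c m (bas b) =
  \sum_j (c j * (b.1 (j, m))%:R) *: bas ((b.1 `\ (j, m))%mset, b.2).
Proof. exact: lext_bas. Qed.

Lemma creation_comm (c e : J -> C) m n (v : fock) :
  creation c m (creation e n v) = creation e n (creation c m v).
Proof.
move: v; apply: (@fock_ind _ (creation c m \o creation e n) (creation e n \o creation c m)).
move=> b /=; rewrite !creation_bas !linear_sum /=.
under eq_bigr do rewrite linearZ_LR /= creation_bas scaler_sumr.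
under [RHS]eq_bigr do rewrite linearZ_LR /= creation_bas scaler_sumr.
rewrite exchange_big; apply: eq_bigr => j _; apply: eq_bigr => l _.
rewrite !scalerA mulrC; congr (_ *: bas (_, _)).
by apply/msetP=> x; rewrite !msetE2 addnCA.
Qed.

Lemma annihilation_comm (c e : J -> C) m n (v : fock) :
  annihilation c m (annihilation e n v) = annihilation e n (annihilation c m v).
Proof.
move: v; apply: (@fock_ind _ (annihilation c m \o annihilation e n)
  (annihilation e n \o annihilation c m)).
move=> b /=; rewrite !annihilation_bas !linear_sum /=.
under eq_bigr do rewrite linearZ_LR /= annihilation_bas scaler_sumr.
under [RHS]eq_bigr do rewrite linearZ_LR /= annihilation_bas scaler_sumr.
rewrite exchange_big; apply: eq_bigr => j _; apply: eq_bigr => l _.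
rewrite !scalerA.
have -> : ((b.1 `\ (l, n)) `\ (j, m) = (b.1 `\ (j, m)) `\ (l, n))%mset.
  by apply/msetP=> x; rewrite !msetE2 subnAC.
congr (_ *: _); rewrite !msetB1E.
rewrite mulrACA [RHS]mulrACA [e l * _]mulrC; congr (_ * _).
rewrite -!natrM; congr (_%:R).
by have [->|_] := eqVneq (j, m) (l, n); rewrite // !subn0 mulnC.
Qed.

Lemma annihilation_creation (c e : J -> C) m n (v : fock) :
  annihilation e n (creation c m v) =
  creation c m (annihilation e n v) + ((m == n)%:R * \sum_j e j * c j) *: v.
Proof.
move: v.
apply: (@fock_ind _ (annihilation e n \o creation c m)
  (creation c m \o annihilation e n \+ ((m == n)%:R * \sum_j e j * c j) \*: idfun)).
move=> b /=; rewrite annihilation_bas creation_bas !linear_sum /=.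
under eq_bigr do rewrite linearZ_LR /= annihilation_bas scaler_sumr.
under [X in _ = X + _]eq_bigr do rewrite linearZ_LR /= creation_bas scaler_sumr.
rewrite [X in _ = X + _]exchange_big mulr_sumr scaler_suml -big_split /=.
apply: eq_bigr => j _.
have -> : ((m == n)%:R * (e j * c j)) *: bas b =
    \sum_l (c j * (e l * ((l, n) == (j, m))%:R)) *:
       bas ((((j, m) +` b.1) `\ (l, n))%mset, b.2).
  rewrite (bigD1 j) //= big1 => [|l nlj]; last first.
    by rewrite xpair_eqE (negbTE nlj) !mulr0 scale0r.
  rewrite addr0 xpair_eqE eqxx /= [n == m]eq_sym.
  have [<-|] := eqVneq m n; last by rewrite !(mul0r, mulr0) !scale0r.
  rewrite mul1r mulr1 mulrC; case: b => A p /=; congr (_ *: bas (_, _)).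
  by apply/msetP=> x; rewrite !msetE2 msetnE addKn.
rewrite -big_split /=; apply: eq_bigr => l _.
rewrite !scalerA.
have -> : (((j, m) +` b.1)%mset (l, n))%:R =
    (b.1 (l, n))%:R + ((l, n) == (j, m))%:R :> C.
  by rewrite mset1DE addnC natrD.
rewrite mulrDr mulrDr scalerDl; congr (_ + _).
case E : (b.1 (l, n)) => [|a]; first by rewrite !mulr0 mul0r !scale0r.
rewrite [c j * _]mulrC; congr (_ *: bas (_, _)).
apply/msetP=> x; rewrite !msetE2 addnBA // msetnE; case: eqP => // ->.
by rewrite E.
Qed.

(* x^{l(b)} on the basis vector b, as a series in x^{1/k} *)
Definition xpow (k : nat) (l : monomial -> C) : series fock :=
  fun q => lext (fun b => if q%:~R / k%:R == l b then bas b else 0).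

Lemma diag_creation (f : P -> C) (c : J -> C) m (v : fock) :
  lext (fun b : monomial => f b.2 *: bas b) (creation c m v) =
  creation c m (lext (fun b : monomial => f b.2 *: bas b) v).
Proof.
set D := lext _; move: v; apply: (@fock_ind _ (D \o creation c m) (creation c m \o D)).
move=> b /=; rewrite /D lext_bas linearZ_LR /= creation_bas linear_sum scaler_sumr.
apply: eq_bigr => j _; rewrite linearZ_LR /= lext_bas /= !scalerA.
by rewrite mulrC.
Qed.

Lemma diag_annihilation (f : P -> C) (c : J -> C) m (v : fock) :
  lext (fun b : monomial => f b.2 *: bas b) (annihilation c m v) =
  annihilation c m (lext (fun b : monomial => f b.2 *: bas b) v).
Proof.
set D := lext _; move: v; apply: (@fock_ind _ (D \o annihilation c m) (annihilation c m \o D)).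
move=> b /=; rewrite /D lext_bas linearZ_LR /= annihilation_bas linear_sum scaler_sumr.
apply: eq_bigr => j _; rewrite linearZ_LR /= lext_bas /= !scalerA.
by rewrite mulrC.
Qed.

Lemma diag_comm (f g : P -> C) (v : fock) :
  lext (fun b : monomial => f b.2 *: bas b) (lext (fun b : monomial => g b.2 *: bas b) v) =
  lext (fun b : monomial => g b.2 *: bas b) (lext (fun b : monomial => f b.2 *: bas b) v).
Proof.
set D := lext _; set E := lext _; move: v; apply: (@fock_ind _ (D \o E) (E \o D)).
by move=> b /=; rewrite /D /E !lext_bas !linearZ_LR /= !lext_bas !scalerA mulrC.
Qed.

(* modes built from creation, diagonal and annihilation operators satisfy the
   relations of a Heisenberg algebra *)
Variables (H : Type) (cr an : H -> nat -> J -> C) (z : H -> P -> C).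

Definition fock_mode (h : H) (n : int) : fock -> fock :=
  match n with
  | Negz m => creation (cr h m) m
  | Posz 0 => lext (fun b : monomial => z h b.2 *: bas b)
  | Posz m.+1 => annihilation (an h m) m
  end.

Lemma fock_mode_comm h h' m n v :
  fock_mode h m (fock_mode h' n v) = fock_mode h' n (fock_mode h m v) +
   (if m + n == 0 then
      match m with
      | Posz 0 => 0
      | Posz p.+1 => \sum_j an h p j * cr h' p j
      | Negz p => - \sum_j an h' p j * cr h p j
      end else 0) *: v.
Proof.
case: m => [[|m]|m]; case: n => [[|n]|n] /=.
- by rewrite scale0r addr0 diag_comm.
- by rewrite scale0r addr0 diag_annihilation.
- by rewrite scale0r addr0 diag_creation.
- by rewrite scale0r addr0 diag_annihilation.
- by rewrite scale0r addr0 annihilation_comm.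
- rewrite annihilation_creation (_ : (m.+1%:Z + Negz n == 0) = (n == m)); last lia.
  by have [->|_] := eqVneq n m; rewrite ?mul1r ?mul0r.
- by rewrite scale0r addr0 diag_creation.
- rewrite annihilation_creation (_ : (Negz m + n.+1%:Z == 0) = (m == n)); last lia.
  have [->|_] := eqVneq m n; rewrite ?mul1r ?mul0r ?scale0r ?addr0 //.
  by rewrite -addrA -scalerDl subrr scale0r addr0.
- by rewrite scale0r addr0 creation_comm.
Qed.

End Fock.

(* [hop h m] is the action of the mode h(m/k). *)
Section NormalOrdering.
Variables (C : numClosedFieldType) (k : nat) (M : lmodType C) (H : Type).
Variable hop : H -> int -> M -> M.

(* h(x) = \sum_{n in Z/k} h(n) x^{-n-1}, and its parts with n < 0, n >= 0,
   n > 0 *)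
Definition heis_field (h : H) : series M := fun q => hop h (- q - k%:Z).
Definition field_neg (h : H) : series M :=
  fun q w => if - q - k%:Z < 0 then heis_field h q w else 0.
Definition field_nneg (h : H) : series M :=
  fun q w => if 0 <= - q - k%:Z then heis_field h q w else 0.
Definition field_pos (h : H) : series M :=
  fun q w => if 0 < - q - k%:Z then heis_field h q w else 0.

(* : exp(\int (h(x) - h(0) x^{-1})) e x^{l} :  *)
Definition normal_exp (h : H) (e : M -> M) (xl : series M) : series M :=
  smul (sexp (sint k (field_neg h)))
    (smul (sconst e) (smul (sexp (sint k (field_pos h))) xl)).

(* (1/m!) (d/dx)^m *)
Definition divder (m : nat) (f : series M) : series M :=
  sscale (m`!%:R)^-1 (iter m (sder k) f).

(* : (1/m!)(d/dx)^m h(x) E(x) : *)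
Definition normal_mul (m : nat) (h : H) (E : series M) : series M :=
  sadd (smul (divder m (field_neg h)) E) (smul E (divder m (field_nneg h))).

End NormalOrdering.

(* For v = b_{j_1}(-m_1-1) ... b_{j_r}(-m_r-1) iota(e_alpha), the operator
   : \prod_i (1/m_i!)(d/dx)^{m_i} b_{j_i}(x) E(alpha) :, extended linearly. *)
Definition normal_vop (C : numClosedFieldType) (k : nat) (M : lmodType C)
    (H : Type) (hop : H -> int -> M -> M) (J : finType) (P : choiceType)
    (b : J -> H) (E : P -> series M) (v : fock C J P) : series M :=
  fun q w => lext (fun x : monomial J P =>
    foldr (fun jm => normal_mul k hop jm.2 (b jm.1)) (E x.2)
      (x.1 : {mset (J * nat)}%mset) q w) v.

(* A lattice of rank #|I| with a chosen Z-basis (b_i) is Z^I together with its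
   Gram matrix G; its complexification is C^I. *)
Section Lattice.
Variables (C : numClosedFieldType) (I : finType) (G : I -> I -> int).

Definition lattice := {ffun I -> int}.

Definition form (a b : lattice) : int := \sum_i \sum_j a i * b j * G i j.

Definition cform (h h' : I -> C) : C :=
  \sum_i \sum_j h i * h' j * (G i j)%:~R.

Definition complexify (a : lattice) : I -> C := fun i => (a i)%:~R.

Definition basis_vec (i : I) : I -> C := fun j => (i == j)%:R.

Definition even_posdef_lattice : Prop :=
  [/\ forall i j, G i j = G j i,
      forall a, (2 %| form a a)%Z
    & forall a, a != 0 -> 0 < form a a].

Definition orthonormal_basis (b : I -> I -> C) : Prop :=
  forall i j, cform (b i) (b j) = (i == j)%:R.

(* A central extension of the lattice by <eta0> together with a section
   alpha |-> e_alpha, e_0 = 1, is the set <eta0> x lattice, (z, alpha) standing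
   for z e_alpha, with the product determined by
   e_alpha e_beta = eps(alpha, beta) e_{alpha + beta}. *)
Definition hat := (C * lattice)%type.

Definition in_hat (eta0 : C) (a : hat) : Prop := exists n : nat, a.1 = eta0 ^+ n.

Definition hmul (eps : lattice -> lattice -> C) (a b : hat) : hat :=
  (a.1 * b.1 * eps a.2 b.2, a.2 + b.2).

Definition hinv (eps : lattice -> lattice -> C) (a : hat) : hat :=
  ((a.1 * eps a.2 (- a.2))^-1, - a.2).

(* eps defines a central extension by <eta0>, with normalized section, whose
   commutator map is C_0(alpha, beta) = (-1)^<alpha, beta> *)
Definition is_extension (eta0 : C) (eps : lattice -> lattice -> C) : Prop :=
  [/\ forall a b, exists n : nat, eps a b = eta0 ^+ n,
      forall a, eps 0 a = 1 /\ eps a 0 = 1,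
      forall a b c, eps a b * eps (a + b) c = eps b c * eps a (b + c)
    & forall a b, eps a b / eps b a = (-1) ^ form a b].

(* V_Q = M(1) \otimes C{Q}: the variable (i, m) is b_i(-m-1), and alpha in the
   second component is iota(e_alpha). *)
Definition latVOA := fock C I lattice.
HB.instance Definition _ := GRing.Lmodule.on latVOA.

Definition heis (h : I -> C) (n : int) : latVOA -> latVOA :=
  match n with
  | Negz m => creation h m
  | Posz 0 => lext (fun b => cform h (complexify b.2) *: bas C b)
  | Posz m.+1 => annihilation (fun i => m.+1%:R * cform h (basis_vec i)) m
  end.

Lemma cform_sym h h' : (forall i j, G i j = G j i) -> cform h h' = cform h' h.
Proof.
move=> symG; rewrite /cform exchange_big; apply: eq_bigr => i _.
by apply: eq_bigr => j _; rewrite symG [h j * _]mulrC.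
Qed.

Lemma cform_sumr (A : finType) h (c : A -> C) (w : A -> I -> C) :
  cform h (fun p => \sum_a c a * w a p) = \sum_a c a * cform h (w a).
Proof.
rewrite /cform.
under [RHS]eq_bigr do rewrite mulr_sumr.
rewrite [RHS]exchange_big; apply: eq_bigr => i _.
under [RHS]eq_bigr do rewrite mulr_sumr.
rewrite [RHS]exchange_big; apply: eq_bigr => j _.
rewrite mulr_sumr mulr_suml; apply: eq_bigr => a _; ring.
Qed.

Lemma eq_cform h1 h2 k1 k2 : h1 =1 h2 -> k1 =1 k2 -> cform h1 k1 = cform h2 k2.
Proof.
by move=> e f; apply: eq_bigr => i _; apply: eq_bigr => j _; rewrite e f.
Qed.

Lemma basis_vecE (h : I -> C) : h =1 (fun p => \sum_i h i * basis_vec i p).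
Proof.
move=> p; rewrite (bigD1 p) //= /basis_vec eqxx mulr1 big1 ?addr0 // => i ip.
by rewrite (negbTE ip) mulr0.
Qed.

Lemma heis_comm (h h' : I -> C) m n (v : latVOA) : (forall i j, G i j = G j i) ->
  heis h m (heis h' n v) =
  heis h' n (heis h m v) + (if m + n == 0 then m%:~R * cform h h' else 0) *: v.
Proof.
move=> symG.
pose md := @fock_mode C I lattice (I -> C) (fun h _ => h)
  (fun h m i => m.+1%:R * cform h (basis_vec i)) (fun h a => cform h (complexify a)).
have mdE g p w : heis g p w = md g p w by case: p => [[|p]|p].
rewrite !mdE /md fock_mode_comm; congr (_ + _ *: _); case: ifP => // _.
have E g g' p : \sum_j p.+1%:R * cform g (basis_vec j) * g' j = p.+1%:R * cform g g'.
  rewrite (eq_cform (frefl g) (basis_vecE g')) cform_sumr mulr_sumr.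
  by apply: eq_bigr => j _; ring.
case: m => [[|m]|m]; rewrite ?mul0r ?E //.
by rewrite cform_sym // NegzE mulrNz mulNr.
Qed.

Variable eps : lattice -> lattice -> C.

Definition iota_e (a : lattice) : latVOA := bas C (mset0, a).

Definition lvac : latVOA := iota_e 0.

Definition Yexp (a : lattice) : series latVOA :=
  normal_exp 1 heis (complexify a)
    (lext (fun b => eps a b.2 *: bas C (b.1, a + b.2)))
    (xpow 1 (fun b : monomial I lattice => cform (complexify a) (complexify b.2))).

Definition Ylat (v : latVOA) : series latVOA :=
  normal_vop 1 heis basis_vec Yexp v.

Definition lomega (h : I -> I -> C) : latVOA :=
  2^-1 *: \sum_i heis (h i) (-1) (heis (h i) (-1) lvac).

(* the eigenvalue of L(0) on a basis vector *)
Definition wt (b : monomial I lattice) : int :=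
  \sum_(jm <- (b.1 : {mset (I * nat)}%mset)) jm.2.+1%:Z + (form b.2 b.2 %/ 2)%Z.

End Lattice.

Section Setting.
Variables (C : numClosedFieldType) (d : nat) (G : 'M[int]_d).
Variables (k : nat) (k_gt0 : (0 < k)%N) (eta : C).

Let IL := ('I_k * 'I_d)%type.

Definition latK := lattice 'I_d.
Definition latL := lattice IL.

Definition gramL (p q : IL) : int := if p.1 == q.1 then G p.2 q.2 else 0.

Definition VK := latVOA C 'I_d.
HB.instance Definition _ := GRing.Lmodule.on VK.
Definition VL := latVOA C IL.
HB.instance Definition _ := GRing.Lmodule.on VL.

Definition fst_ix : 'I_k := Ordinal k_gt0.

(* nu(alpha_1, ..., alpha_k) = (alpha_2, ..., alpha_k, alpha_1) on L and h *)
Definition nu (a : latL) : latL := [ffun p => a (ordS p.1, p.2)].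
Definition nu_inv (a : latL) : latL := [ffun p => a (ord_pred p.1, p.2)].
Definition nuh (h : IL -> C) : IL -> C := fun p => h (ordS p.1, p.2).
Definition nuh_inv (h : IL -> C) : IL -> C := fun p => h (ord_pred p.1, p.2).

(* (alpha, 0, ..., 0) *)
Definition in_first (a : latK) : latL := [ffun p => if p.1 == fst_ix then a p.2 else 0].

Definition component (a : latL) (j : 'I_k) : latK := [ffun i => a (j, i)].

(* v |-> v^1 = v \otimes 1 \otimes ... \otimes 1 *)
Definition factor1 : VK -> VL :=
  lext (fun b : monomial 'I_d latK =>
    bas C (seq_mset [seq ((fst_ix, im.1), im.2) | im <- (b.1 : {mset ('I_d * nat)}%mset)],
           in_first b.2)).

(* nu-hat on V_L: v_1 \otimes ... \otimes v_k |-> v_2 \otimes ... \otimes v_1;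
   it moves the vector in factor j to factor j - 1 (cyclically) *)
Definition move_factors (s : 'I_k -> 'I_k) (t : latL -> latL) : VL -> VL :=
  lext (fun b : monomial IL latL =>
    bas C (seq_mset [seq ((s pm.1.1, pm.1.2), pm.2) | pm <- (b.1 : {mset (IL * nat)}%mset)],
           t b.2)).
Definition nuhat : VL -> VL := move_factors (@ord_pred k) nu.
Definition nuhat_inv : VL -> VL := move_factors (@ordS k) nu_inv.

(* v^{j+1} = nu-hat^{-j}(v^1) *)
Definition tensor_factor (j : nat) (v : VK) : VL := iter j nuhat_inv (factor1 v).

Definition eta0 : C := (-1) ^+ k * eta.

Variable eps : latK -> latK -> C.

(* L-hat is the quotient of K-hat^k, with e_alpha = e_{alpha_1} ... e_{alpha_k} *)
Definition epsL (a b : latL) : C := \prod_(j < k) eps (component a j) (component b j).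

Definition YK : VK -> series VK := Ylat G eps.
Definition YL : VL -> series VL := Ylat gramL epsL.

(* a \times_nu b =
   \prod_{0<j<k/2} (-eta^j)^{-<nu^{-j} a, b>} a \times b *)
Definition eps_nu (a b : latL) : C :=
  epsL a b * \prod_(1 <= j < k | (j.*2 < k)%N)
    (- eta ^+ j) ^ (- form gramL (iter j nu_inv a) b).

Definition hatL := hat C IL.

Definition nu_hat (a : hatL) : hatL := (a.1, nu a.2).

(* N = {alpha in L : <alpha, h_(0)> = 0} *)
Definition in_N (a : latL) : Prop :=
  forall h : IL -> C, nuh h =1 h -> cform gramL (complexify C a) h = 0.

Definition in_Nhat (a : hatL) : Prop := in_hat eta0 a /\ in_N a.2.

Definition is_tau (tau : hatL -> C) : Prop :=
  [/\ forall a, in_Nhat a -> tau a != 0,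
      forall a b, in_Nhat a -> in_Nhat b ->
        tau (hmul eps_nu a b) = tau a * tau b,
      tau (eta0, 0) = eta0
    & forall a, in_hat eta0 a ->
        tau (hmul eps_nu a (hinv eps_nu (nu_hat a))) =
          eta ^ (- ((\sum_(j < k) form gramL (iter j nu a.2) a.2) %/ 2)%Z)].

(* projection of h to h_(n) = {h : nu h = eta^n h} *)
Definition nu_proj (n : int) (h : IL -> C) : IL -> C :=
  fun p => k%:R^-1 * \sum_(r < k) eta ^ (- (n * r%:Z)) * iter r nuh h p.

(* V_L^T = S[nu] \otimes U_T.  The variable (i, m) is
   (b_i, 0, ..., 0)_(-m-1) \otimes t^{-(m+1)/k}; for each n the vectors
   (b_i, 0, ..., 0)_(n) form a basis of h_(n), the i-th coordinate of h in h_(n)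
   being k times that of the first component of h.  As L is the direct sum of
   {(alpha, 0, ..., 0)} and N, the e_(alpha,0,...,0) represent the cosets of
   N-hat, so that U_T has basis the e_(alpha,0,...,0) \otimes 1, denoted by
   alpha in K. *)
Definition VLT := fock C 'I_d latK.
HB.instance Definition _ := GRing.Lmodule.on VLT.

(* [heisT h m] is h^T(m/k) *)
Definition heisT (h : IL -> C) (m : int) : VLT -> VLT :=
  match m with
  | Negz n => creation (fun i => k%:R * nu_proj m h (fst_ix, i)) n
  | Posz 0 => lext (fun b =>
      cform gramL (nu_proj 0 h) (complexify C (in_first b.2)) *: bas C b)
  | Posz n.+1 => annihilation (fun i => (n.+1%:R / k%:R) *
      cform gramL (nu_proj m h) (nu_proj (- m) (basis_vec C (fst_ix, i)))) n
  end.

Section HeisT.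
Hypothesis eta_prim : k.-primitive_root eta.
Hypothesis symG : forall i j, G i j = G j i.
Local Notation o := fst_ix.

Let k_neq0 : k%:R != 0 :> C. Proof. by rewrite pnatr_eq0 -lt0n. Qed.

Let eta_neq0 : eta != 0.
Proof.
apply: contra_eq_neq (prim_expr_order eta_prim) => ->.
by rewrite expr0n gtn_eqF // eq_sym oner_eq0.
Qed.

Lemma iter_ordS r (j : 'I_k) : iter r (@ordS k) j = ((j + r) %% k)%N :> nat.
Proof.
elim: r => [|r IHr] /=; first by rewrite addn0 modn_small.
by rewrite IHr -addn1 modnDml addn1 addnS.
Qed.

Lemma iter_nuh r (h : IL -> C) j i :
  iter r nuh h (j, i) = h (iter r (@ordS k) j, i).
Proof. by elim: r h j => [|r IHr] h j //; rewrite iterSr IHr iterS. Qed.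

(* nu_proj n h is in h_(n) *)
Lemma nu_nu_proj n (h : IL -> C) :
  nuh (nu_proj n h) =1 (fun p => eta ^ n * nu_proj n h p).
Proof.
case=> j i; rewrite /nuh /nu_proj /= mulrCA; congr (_ * _).
rewrite mulr_sumr.
pose f r := eta ^ (- (n * r%:Z)) * h (iter r (@ordS k) j, i).
have f0k : f k = f 0%N.
  rewrite /f mulr0 oppr0 expr0z; congr (_ * h (_, _)); last first.
    by apply: val_inj; rewrite /= iter_ordS modnDr modn_small.
  by rewrite mulrC -mulrN -exprz_exp -exprnP (prim_expr_order eta_prim) exp1rz.
transitivity (eta ^ n * \sum_(r < k) f r.+1).
  rewrite mulr_sumr; apply: eq_bigr => r _; rewrite iter_nuh /f iterSr mulrA.
  by rewrite -expfzDr //; congr (eta ^ _ * _); rewrite intS; ring.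
rewrite -mulr_sumr; congr (_ * _).
under [RHS]eq_bigr do rewrite iter_nuh.
apply: (addrI (f 0%N)); rewrite -(big_ord_recl k f) big_ord_recr /= f0k.
by rewrite addrC.
Qed.

Lemma nu_proj_first n (h : IL -> C) j i :
  nu_proj n h (j, i) = eta ^ (n * j%:Z) * nu_proj n h (o, i).
Proof.
have -> : j = iter j (@ordS k) o.
  by apply: val_inj; rewrite /= iter_ordS /= add0n modn_small.
have: (j < k)%N by [].
rewrite iter_ordS add0n modn_small //; move: (j : nat) => r _.
elim: r => [|r IHr] /=; first by rewrite mulr0 expr0z mul1r.
rewrite -[LHS]/(nuh (nu_proj n h) (iter r (@ordS k) o, i)) nu_nu_proj IHr.
by rewrite mulrA -expfzDr //; congr (eta ^ _ * _); rewrite intS; ring.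
Qed.

(* h_(n) is spanned by the projections of the (b_i, 0, ..., 0) *)
Lemma nu_proj_basis n (h : IL -> C) : nu_proj n h =1 (fun p =>
  \sum_(i < d) k%:R * nu_proj n h (o, i)
     * nu_proj n (basis_vec C (o, i)) p).
Proof.
case=> j i; rewrite nu_proj_first (bigD1 i) //= big1 => [|l li]; last first.
  rewrite [X in _ * X]/nu_proj big1 ?mulr0 // => r _.
  by rewrite iter_nuh /basis_vec xpair_eqE (negbTE li) andbF mulr0.
rewrite [nu_proj _ (basis_vec _ _) _]nu_proj_first.
rewrite [nu_proj _ (basis_vec _ _) _]/nu_proj.
rewrite (bigD1 (Ordinal k_gt0)) //= big1 => [|r r0]; last first.
  rewrite iter_nuh /basis_vec xpair_eqE eqxx andbT -val_eqE /=.
  rewrite iter_ordS /= add0n modn_small // eq_sym.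
  by rewrite -val_eqE /= in r0; rewrite (negbTE r0) mulr0.
rewrite mulr0 oppr0 expr0z mul1r /basis_vec eqxx !addr0 mulr1.
by rewrite mulrACA mulrCA -mulrA mulrA; field.
Qed.

Lemma heisT_comm (h h' : IL -> C) m n (v : VLT) :
  heisT h m (heisT h' n v) =
  heisT h' n (heisT h m v)
  + (if m + n == 0 then
       (m%:~R / k%:R) * cform gramL (nu_proj m h) (nu_proj n h')
     else 0) *: v.
Proof.
pose md := @fock_mode C 'I_d latK (IL -> C)
  (fun h n i => k%:R * nu_proj (Negz n) h (o, i))
  (fun h n i => (n.+1%:R / k%:R) * cform gramL
     (nu_proj n.+1 h) (nu_proj (- n.+1%:Z) (basis_vec C (o, i))))
  (fun h s => cform gramL (nu_proj 0 h) (complexify C (in_first s))).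
have mdE g p w : heisT g p w = md g p w by case: p => [[|p]|p].
rewrite !mdE /md fock_mode_comm; congr (_ + _ *: _); case: ifP => // /eqP mn0.
have -> : n = - m by apply/eqP; rewrite -addr_eq0 addrC mn0.
have symL p q : gramL p q = gramL q p by rewrite /gramL eq_sym symG.
have E g g' p : \sum_j p.+1%:R / k%:R * cform gramL (nu_proj p.+1 g)
      (nu_proj (- p.+1%:Z) (basis_vec C (o, j))) *
      (k%:R * nu_proj (Negz p) g' (o, j)) =
    p.+1%:R / k%:R * cform gramL (nu_proj p.+1 g) (nu_proj (- p.+1%:Z) g').
  rewrite [in RHS](eq_cform _ (frefl _) (nu_proj_basis (- p.+1%:Z) g')).
  rewrite cform_sumr mulr_sumr; apply: eq_bigr => j _; rewrite NegzE.
  by rewrite -mulrA; congr (_ * _); rewrite mulrC.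
case: m {mn0} => [[|m]|m]; rewrite ?mul0r ?E //.
by rewrite NegzE mulrNz opprK mulNr cform_sym // mulNr.
Qed.
End HeisT.

Variable tau : hatL -> C.

(* For b in L-hat_nu, b \otimes 1 = tau(n) e_(s,0,...,0) \otimes 1 where
   b = e_(s,0,...,0) n with n in N-hat, s being the sum of the components of
   b-bar. *)
Definition coset_rep (b : latL) : latK := \sum_(j < k) component b j.
Definition coset_coef (b : hatL) : C :=
  tau (hmul eps_nu (hinv eps_nu (1, in_first (coset_rep b.2))) b).

(* 1 \otimes (b \otimes 1) *)
Definition utens (b : hatL) : VLT :=
  coset_coef b *: bas C (mset0, coset_rep b.2).

(* 1 \otimes (1 \otimes 1) *)
Definition vacT : VLT := utens (1, 0).

(* a.(b \otimes 1) = ab \otimes 1, with b = e_(s,0,...,0) *)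
Definition hat_act (a : hatL) : VLT -> VLT :=
  lext (fun x : monomial 'I_d latK =>
    let ab := hmul eps_nu a (1, in_first x.2) in
    coset_coef ab *: bas C (x.1, coset_rep ab.2)).

Definition sigma (a : latL) : C :=
  (\prod_(1 <= j < k | (j.*2 < k)%N)
     (1 - eta ^ (- j%:Z)) ^ form gramL (iter j nu a) a) *
  (if odd k then 1
   else 2%:R ^ (form gramL (iter k./2 nu a) a %/ 2)%Z).

(* Y^{nu-hat}(e_a, x) *)
Definition YTexp (a : latL) : series VLT :=
  let h := complexify C a in
  let h0 := nu_proj 0 h in
  sscale (k%:R ^ (- (form gramL a a %/ 2)%Z) * sigma a)
    (normal_exp k heisT h (hat_act (1, a))
       (xpow k (fun b : monomial 'I_d latK =>
          cform gramL h0 (complexify C (in_first b.2))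
          + cform gramL h0 h0 / 2%:R - cform gramL h h / 2%:R))).

Definition Wop (v : VL) : series VLT :=
  normal_vop k heisT (@basis_vec C IL) YTexp v.

(* Formal power series in (x, y): [f m n] is the coefficient of x^m y^n. *)
Definition pser2 := nat -> nat -> C.
Definition pmul2 (f g : pser2) : pser2 := fun m n =>
  \sum_(i < m.+1) \sum_(j < n.+1) f i j * g (m - i)%N (n - j)%N.
Definition pone2 : pser2 := fun m n => ((m == 0%N) && (n == 0%N))%:R.

(* log f = \sum_{i >= 1} (-1)^{i+1} (f - 1)^i / i for f with constant term 1;
   only i <= m + n contribute to the coefficient of x^m y^n *)
Definition plog2 (f : pser2) : pser2 := fun m n =>
  \sum_(1 <= i < (m + n).+1) ((-1) ^+ i.+1 / i%:R) *
    iter i (pmul2 (fun m n => f m n - pone2 m n)) pone2 m n.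

(* ((1+x)^{1/k} - eta^{-j} (1+y)^{1/k}) / (1 - eta^{-j}) *)
Definition quot_ser (j : nat) : pser2 := fun m n =>
  ((n == 0%N)%:R * gbinom (k%:R^-1) m
   - eta ^ (- j%:Z) * ((m == 0%N)%:R * gbinom (k%:R^-1) n))
  / (1 - eta ^ (- j%:Z)).

Definition cmnr (m n r : nat) : C :=
  if r == 0%N then - 2^-1 * \sum_(1 <= j < k) plog2 (quot_ser j) m n
  else 2^-1 * plog2 (quot_ser r) m n.

(* Delta_x, for the orthonormal basis beta of h; integral powers of x *)
Definition Delta (beta : IL -> IL -> C) : series VL := fun q v =>
  if q <= 0 then
    \sum_(m < `|q|%N.+1) \sum_(r < k) \sum_(j : IL)
      cmnr m (`|q|%N - m)%N r *:
        heis gramL (iter r nuh_inv (beta j)) m%:Z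
          (heis gramL (beta j) (`|q|%N - m)%N%:Z v)
  else 0.

(* Y^{nu-hat}(v, x) = W(e^{Delta_x} v, x) *)
Definition YT (beta : IL -> IL -> C) : VL -> series VLT :=
  insert_series k%:Z (sexp (Delta beta)) Wop.

(* Formal power series in x: exp(-\sum_{j>=1} a_j x^{j+1} d/dx).x =
   (1/k)(1+x)^k - 1/k.  The derivation raises degrees, so that only its first
   p powers contribute to the coefficient of x^p. *)
Definition euler_field (a : nat -> C) (f : nat -> C) : nat -> C :=
  fun p => - \sum_(1 <= j < p.+1) a j * (p - j)%:R * f (p - j)%N.

Definition is_bdm_coeffs (a : nat -> C) : Prop :=
  forall p : nat,
    \sum_(i < p.+1) (i`!%:R)^-1 *
      iter i (euler_field a) (fun n => (n == 1%N)%:R) p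
    = k%:R^-1 * 'C(k, p)%:R - (if p == 0%N then k%:R^-1 else 0).

Section BDM.
Variables (hK : 'I_d -> 'I_d -> C) (a : nat -> C).

Definition LK (n : int) : VK -> VK := vmode YK (lomega G hK) (n + 1).

(* \sum_{j>=1} a_j x^{-j/k} L(j), as a series in x^{1/k} *)
Definition aL : series VK := fun q v =>
  if q < 0 then a `|q|%N *: LK (- q) v else 0.

(* k^{-L(0)} x^{(1/k-1)L(0)} *)
Definition kxL0 : series VK := fun q =>
  lext (fun b : monomial 'I_d latK =>
    if q == (1 - k%:Z) * wt G b then k%:R ^ (- wt G b) *: bas C b else 0).

Definition Ef : series VK := smul (sexp aL) kxL0.

(* Y(E_f(x^{1/k}) u, x^{1/k}) *)
Definition Ybdm : VK -> series VK := insert_series 1 Ef YK.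

(* Y(u^{j+1}, x) = \lim_{x^{1/k} -> eta^j x^{1/k}} Y(E_f(x^{1/k})u, x^{1/k}) *)
Definition bdm_on_factors (Y : VL -> series VK) : Prop :=
  forall (u : VK) (j : nat), (j < k)%N -> forall q w,
    Y (tensor_factor j u) q w = ssubst (eta ^+ j) (Ybdm u) q w.

End BDM.

(* alpha^T(x) for alpha in L *)
Definition fieldT (a : latL) : series VLT := heis_field k heisT (complexify C a).

(* alpha(x^{1/k}) for alpha in K *)
Definition fieldK (a : latK) : series VK := heis_field 1 (heis G) (complexify C a).

Definition conjugate_series (M1 M2 : lmodType C) (f : M1 -> M2) (f' : M2 -> M1)
    (s : series M1) : series M2 := fun q w => f (s q (f' w)).

(* the two properties characterizing the isomorphism *)
Definition transports_fields (f : VLT -> VK) : Prop :=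
  exists f' : VK -> VLT, [/\ cancel f f', cancel f' f
    & forall (a : latK) q w,
        conjugate_series f f' (fieldT (in_first a)) q w =
          sscale k%:R^-1 (sshift (1 - k%:Z) (fieldK a)) q w].

Definition transports_group_algebra (f : VLT -> VK) : Prop :=
  forall a : latK, f (utens (1, in_first a)) = iota_e C a.

End Setting.

(* Main.v *)
From HB Require Import structures.
Require Import Defs.
From mathcomp Require Import all_boot all_order all_algebra.
From mathcomp Require Import finmap multiset.
From mathcomp Require Import boolp classical_sets functions fsbigop.
From mathcomp Require Import reals complex ring zify.
Import Order.TTheory GRing.Theory Num.Theory.
Local Open Scope ring_scope.

Set Implicit Arguments.
Unset Strict Implicit.
Unset Printing Implicit Defensive.

(** The isomorphism F is given only through the relation
    F(Y(u,x)v) = Y(u,x)F(v), where neither of the two vertex operators is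
    explicit for a general u.  Both become explicit on two kinds of vectors:
    the oscillators b_i(-1)1 placed in one tensor factor, and iota(e_b)^1 for
    b in K.  Such a vector is annihilated by all h(m)h'(n) with m, n >= 0 and
    m + n > 0, and by all h(n) with n > 1 ([quadratic_vacuum]).  Hence Delta_x
    vanishes on it, since c_{000} = ... = c_{00(k-1)} = 0 ([sexp_Delta]), and so
    does every L(n) with n > 0 ([Ylat_omega_quadratic_vacuum]).  Consequently
    e^{Delta_x} acts as the identity and E_f(x^{1/k}) as
    k^{-L(0)} x^{(1/k-1)L(0)} ([YT_quadratic_vacuum],
    [Ybdm_quadratic_vacuum]).

    On b_i(-1)1 in the factor j the two operators are then the field of the
    j-th copy of b_i on V_L^T and k^{-1} x^{1/k-1} b_i(x^{1/k}) after the
    substitution x^{1/k} -> eta^j x^{1/k}.  As the copies of the b_i form a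
    basis of h, linearity gives the action of F on every Heisenberg mode
    ([F_heisT]): the formula for (alpha_1, ..., alpha_k), and its special case
    (alpha, 0, ..., 0).

    Applied to the vacuum vectors, the two operators of iota(e_b)^1 have the
    same leading term k^{-<b,b>/2} x^{(1/k-1)<b,b>/2}, times e_(b,0,...,0)
    tensor 1 on V_L^T and times iota(e_b) on V_K.  The powers of k cancel, and
    F(1) = 1 yields the group algebra statement ([F_group_algebra]).

    Finally, the creation modes of the (alpha, 0, ..., 0) generate V_L^T from
    U_T, so a linear map with the two properties is determined
    ([intertwiner_unique]). *)

(** * Finitely supported sums and formal series *)

(** A sum over an infinite type is zero by convention when its support is
    infinite.  All infinite sums met below are evaluated at vectors for which
    at most one term survives, so convergence never has to be discussed. *)
Lemma fsbig_single (V : nmodType) (T : choiceType) (F : T -> V) t :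
  (forall s, s != t -> F s = 0) -> \sum_(s \in [set: T]) F s = F t.
Proof.
move=> F0; rewrite -[RHS](fsbig_set1 +%R t F); apply/esym/fsbig_widen => //.
by move=> s [_ /= /eqP st]; exact: F0.
Qed.

Lemma sum_pair (V : nmodType) (A B : finType) (F : A * B -> V) :
  \sum_p F p = \sum_x \sum_y F (x, y).
Proof. by rewrite pair_bigA /=; apply: eq_bigr => -[]. Qed.

Section Series.
Variables (C : numClosedFieldType) (M : lmodType C).
Implicit Types (f g : series M) (u v w : M).

Lemma smul_at f g w u q0 : (forall p, f p 0 = 0) ->
  (forall q, g q w = if q == q0 then u else 0) ->
  forall q, smul f g q w = f (q - q0) u.
Proof.
move=> f0 gw q; rewrite /smul (@fsbig_single _ _ _ (q - q0)).
  by rewrite gw (_ : q - (q - q0) == q0) //; apply/eqP; ring.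
move=> s sq; rewrite gw ifN ?f0 //; apply: contra sq => /eqP <-.
by apply/eqP; ring.
Qed.

Lemma smul_sconst (e : M -> M) g q w : smul (sconst e) g q w = e (g q w).
Proof.
rewrite /smul (@fsbig_single _ _ _ 0) /sconst ?eqxx ?subr0 // => s s0.
by rewrite (negbTE s0).
Qed.

(** The powers f^n with n > 0 end by applying a coefficient of f to v. *)
Lemma sexp_killed f v : (forall q, f q 0 = 0) -> (forall q, f q v = 0) ->
  forall q, sexp f q v = sconst id q v.
Proof.
move=> f0 fv q.
have spow0 n p : spow f n.+1 p v = 0.
  elim: n p => [|n IH] p; rewrite /spow iterS -/(spow _ _) /smul fsbig1 // => s _.
    by rewrite /= /sconst; case: ifP => _; rewrite ?fv ?f0.
  by rewrite IH f0.
rewrite /sexp (@fsbig_single _ _ _ 0%N) ?fact0 ?invr1 ?scale1r //.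
by case=> // n _; rewrite spow0 scaler0.
Qed.

Lemma sexp0 f q : (forall p, f p 0 = 0) -> sexp f q 0 = 0.
Proof. by move=> f0; rewrite sexp_killed // /sconst if_same. Qed.

(** If f has only positive powers of x, then so does f^n for n > 0, and the
    constant term of exp f comes from n = 0 alone. *)
Lemma sexp_constant_term f v : (forall q, f q 0 = 0) ->
  (forall q w, q <= 0 -> f q w = 0) -> sexp f 0 v = v.
Proof.
move=> f0 fneg.
have spow0 n p : p <= 0 -> spow f n.+1 p v = 0.
  elim: n p => [|n IH] p p0; rewrite /spow iterS -/(spow _ _) /smul fsbig1 // => s _;
    (have [s0|s0] := lerP s 0; first exact: fneg).
    by rewrite /= /sconst ifN ?f0 //; lia.
  by rewrite IH ?f0 //; lia.
rewrite /sexp (@fsbig_single _ _ _ 0%N) ?fact0 ?invr1 ?scale1r //.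
by case=> // n _; rewrite spow0 ?scaler0.
Qed.

Lemma insert_series_at (V : lmodType C) (s : int) (e : series V)
    (Y : V -> series M) (v u : V) p0 : (forall q w, Y 0 q w = 0) ->
  (forall p, e p v = if p == p0 then u else 0) ->
  forall q w, insert_series s e Y v q w = Y u (q - s * p0) w.
Proof.
move=> Y0 ev q w; rewrite /insert_series (@fsbig_single _ _ _ p0).
  by rewrite ev eqxx.
by move=> p pp0; rewrite ev (negbTE pp0) Y0.
Qed.

Variables (k : nat) (H : Type) (hop : H -> int -> M -> M).
Hypothesis hop0 : forall h n, hop h n 0 = 0.

Lemma sint_field_neg0 h q : sint k (field_neg k hop h) q 0 = 0.
Proof. by rewrite /sint /field_neg /heis_field hop0 if_same scaler0. Qed.

Lemma sint_field_pos0 h q : sint k (field_pos k hop h) q 0 = 0.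
Proof. by rewrite /sint /field_pos /heis_field hop0 if_same scaler0. Qed.

(** On a vector killed by the positive modes the right exponential is the
    identity, and only the creation exponential remains. *)
Lemma normal_exp_lowest h (e : M -> M) (xl : series M) q0 w :
  (forall n, 0 < n -> hop h n w = 0) -> e 0 = 0 ->
  (forall q, xl q w = if q == q0 then w else 0) ->
  forall q, normal_exp k hop h e xl q w =
            sexp (sint k (field_neg k hop h)) (q - q0) (e w).
Proof.
move=> hw e0 xlw q; rewrite /normal_exp.
apply: smul_at => [p|p]; first exact/sexp0/sint_field_neg0.
rewrite smul_sconst (smul_at (q0 := q0) (u := w)) //; last first.
  by move=> r; exact/sexp0/sint_field_pos0.
rewrite sexp_killed /sconst ?subr_eq0; first by case: ifP => // _.
- exact: sint_field_pos0.
move=> r; rewrite /sint /field_pos /heis_field.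
by case: ifP => [/hw ->|_]; rewrite scaler0.
Qed.

Lemma normal_exp_leading h (e : M -> M) (xl : series M) q0 w :
  (forall n, 0 < n -> hop h n w = 0) -> e 0 = 0 ->
  (forall q, xl q w = if q == q0 then w else 0) ->
  normal_exp k hop h e xl q0 w = e w.
Proof.
move=> hw e0 xlw; rewrite (normal_exp_lowest hw e0 xlw) subrr.
rewrite sexp_constant_term //; first exact: sint_field_neg0.
move=> q v q0'; rewrite /sint /field_neg ifN ?scaler0 //; lia.
Qed.

(** For h = 0 this is the operator of the vacuum. *)
Lemma normal_exp_zero h (e : M -> M) (xl : series M) w :
  (forall n v, hop h n v = 0) -> e 0 = 0 -> e w = w ->
  (forall q, xl q w = sconst id q w) ->
  forall q, normal_exp k hop h e xl q w = sconst id q w.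
Proof.
move=> hz e0 ew xlw q.
rewrite (normal_exp_lowest (q0 := 0) _ e0 xlw) // subr0 ew.
by rewrite sexp_killed // => p; rewrite /sint /field_neg /heis_field ?hz if_same scaler0.
Qed.

(** With E = 1 the two halves of the normal ordered product recombine to the
    full field h(x). *)
Lemma normal_mul_const h (E : series M) :
  (forall q w, E q w = sconst id q w) ->
  forall q w, normal_mul k hop 0 h E q w = heis_field k hop h q w.
Proof.
move=> Ec q w; rewrite /normal_mul /sadd (smul_at (q0 := 0) (u := w)); first last.
- by move=> p; rewrite Ec.
- move=> p; rewrite /divder /sscale /= /field_neg /heis_field hop0.
  by rewrite if_same scaler0.
rewrite subr0 /smul (@fsbig_single _ _ _ 0); last first.
  by move=> p p0; rewrite Ec /sconst (negbTE p0).
rewrite Ec /sconst eqxx subr0 /divder /sscale /= fact0 invr1 !scale1r.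
rewrite /field_neg /field_nneg.
by have [?|?] := ltrP (- q - k%:Z) 0; rewrite ?addr0 ?add0r.
Qed.

(** The coefficients of :h1(x)h2(x): are infinite sums of h1(m)h2(n) with m < 0
    and of h2(n)h1(m) with m >= 0, m + n being fixed; both kinds of terms
    vanish under the two hypotheses. *)
Lemma normal_mul_field0 h1 h2 (E : series M) q w :
  (forall q w, E q w = heis_field k hop h2 q w) ->
  (forall m n, m < 0 -> m + n = - q - k%:Z - k%:Z -> hop h1 m (hop h2 n w) = 0) ->
  (forall m n, 0 <= m -> m + n = - q - k%:Z - k%:Z -> hop h2 n (hop h1 m w) = 0) ->
  normal_mul k hop 0 h1 E q w = 0.
Proof.
move=> Eh lt0 ge0; rewrite /normal_mul /sadd /smul !fsbig1 ?addr0 // => p _.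
  rewrite Eh /divder /sscale /= fact0 invr1 scale1r /field_nneg.
  by rewrite /heis_field; case: ifP => pk; rewrite ?hop0 // ge0 //; lia.
rewrite Eh /divder /sscale /= fact0 invr1 scale1r /field_neg.
by rewrite /heis_field; case: ifP => // pk; rewrite lt0 //; lia.
Qed.

End Series.

(** * Modes on a Fock space *)

Section Modes.
Variables (C : numClosedFieldType) (J : finType) (P : choiceType).
Local Notation fock := (fock C J P).
Variables (A : finType) (c : A -> C).

Lemma fock_sum_ind (f : {linear fock -> fock}) (g : A -> {linear fock -> fock}) :
  (forall b, f (bas C b) = \sum_i c i *: g i (bas C b)) ->
  forall v, f v = \sum_i c i *: g i v.
Proof.
pose comb (v : fock) : fock := \sum_i c i *: g i v.
have lin : linear comb.
  move=> a u w; rewrite /comb scaler_sumr -big_split; apply: eq_bigr => i _ /=.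
  by rewrite linearP scalerDr !scalerA mulrC.
pose s := HB.pack_for {linear fock -> fock} comb (GRing.isLinear.Build C fock fock *:%R comb lin).
by move=> fg; apply: (fock_ind (g := s)).
Qed.

Lemma creation_sum (h : A -> J -> C) m (v : fock) :
  creation (fun j => \sum_i c i * h i j) m v = \sum_i c i *: creation (h i) m v.
Proof.
apply: (fock_sum_ind (g := fun i => creation (h i) m)) => b.
rewrite /= creation_bas; under [RHS]eq_bigr do rewrite creation_bas scaler_sumr.
rewrite exchange_big; apply: eq_bigr => j _ /=.
by rewrite scaler_suml; apply: eq_bigr => i _; rewrite scalerA.
Qed.

Lemma annihilation_sum (h : A -> J -> C) m (v : fock) :
  annihilation (fun j => \sum_i c i * h i j) m v =
  \sum_i c i *: annihilation (h i) m v.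
Proof.
apply: (fock_sum_ind (g := fun i => annihilation (h i) m)) => b.
rewrite /= annihilation_bas; under [RHS]eq_bigr do rewrite annihilation_bas scaler_sumr.
rewrite exchange_big; apply: eq_bigr => j _ /=.
by rewrite mulr_suml scaler_suml; apply: eq_bigr => i _; rewrite scalerA mulrA.
Qed.

Lemma diag_sum (z : A -> P -> C) (v : fock) :
  lext (fun b : monomial J P => (\sum_i c i * z i b.2) *: bas C b) v =
  \sum_i c i *: lext (fun b : monomial J P => z i b.2 *: bas C b) v.
Proof.
apply: (fock_sum_ind
  (g := fun i => lext (fun b : monomial J P => z i b.2 *: bas C b))) => b.
rewrite /= lext_bas scaler_suml; apply: eq_bigr => i _.
by rewrite lext_bas scalerA.
Qed.

Lemma xpow_bas (k : nat) (l : monomial J P -> C) b q0 : (0 < k)%N ->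
  q0%:~R / k%:R = l b ->
  forall q, xpow k l q (bas C b) = if q == q0 then bas C b else 0.
Proof.
move=> k_gt0 lb q; rewrite /xpow lext_bas -lb.
have k0 : k%:R != 0 :> C by rewrite pnatr_eq0 -lt0n.
by rewrite (inj_eq (mulIf (invr_neq0 k0))) eqr_int.
Qed.

Lemma xpow_zero (k : nat) (l : monomial J P -> C) : (0 < k)%N ->
  (forall b, l b = 0) -> forall q w, xpow k l q w = sconst id q w.
Proof.
move=> k_gt0 l0 q w.
have E b := xpow_bas k_gt0 (q0 := 0) (b := b) (etrans (mul0r _) (esym (l0 b))) q.
rewrite /sconst; case: eqP E => [-> | /eqP q0] E.
  apply: (fock_ind (f := lext _) (g := idfun)) => b /=.
  exact: E.
by apply: (fock_ind (f := lext _) (g := \0)) => b; exact: E.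
Qed.

End Modes.

(** * Bilinear forms and Heisenberg modes *)

Lemma lform0l (I : finType) (G : I -> I -> int) b : Defs.form G 0 b = 0.
Proof.
by rewrite /Defs.form big1 // => i _; rewrite big1 // => j _; rewrite ffunE !mul0r.
Qed.

Lemma lformNl (I : finType) (S : I -> I -> int) (x y : lattice I) :
  Defs.form S (- x) y = - Defs.form S x y.
Proof.
rewrite /Defs.form -sumrN; apply: eq_bigr => i _; rewrite -sumrN.
by apply: eq_bigr => j _; rewrite ffunE !mulNr.
Qed.

Lemma lformNr (I : finType) (S : I -> I -> int) (x y : lattice I) :
  Defs.form S x (- y) = - Defs.form S x y.
Proof.
rewrite /Defs.form -sumrN; apply: eq_bigr => i _; rewrite -sumrN.
by apply: eq_bigr => j _; rewrite ffunE mulrN mulNr.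
Qed.

Lemma lform0r (I : finType) (S : I -> I -> int) (x : lattice I) :
  Defs.form S x 0 = 0.
Proof.
by rewrite /Defs.form big1 // => i _; rewrite big1 // => j _; rewrite ffunE mulr0 mul0r.
Qed.

Section HeisenbergModes.
Variables (C : numClosedFieldType) (I : finType) (G : I -> I -> int).
Implicit Types (h : I -> C) (n : int) (v w : latVOA C I).

Lemma cform_suml (A : finType) (c : A -> C) (h : A -> I -> C) h' :
  cform G (fun p => \sum_a c a * h a p) h' = \sum_a c a * cform G (h a) h'.
Proof.
rewrite /cform; under [RHS]eq_bigr do rewrite mulr_sumr.
rewrite [RHS]exchange_big; apply: eq_bigr => i _.
under [RHS]eq_bigr do rewrite mulr_sumr.
rewrite [RHS]exchange_big; apply: eq_bigr => j _.
by rewrite !mulr_suml; apply: eq_bigr => a _; rewrite !mulrA.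
Qed.

Lemma cform0l h : cform G (fun=> 0) h = 0.
Proof.
by rewrite /cform big1 // => i _; rewrite big1 // => j _; rewrite !mul0r.
Qed.

Lemma cform0r h : cform G h (fun=> 0) = 0.
Proof.
by rewrite /cform big1 // => i _; rewrite big1 // => j _; rewrite mulr0 mul0r.
Qed.

Lemma complexify0 : complexify C (0 : lattice I) = fun=> 0.
Proof. by apply: funext => i; rewrite /complexify ffunE. Qed.

Lemma cform_complexify (a b : lattice I) :
  cform G (complexify C a) (complexify C b) = (Defs.form G a b)%:~R.
Proof.
rewrite /cform /Defs.form rmorph_sum; apply: eq_bigr => i _.
by rewrite rmorph_sum; apply: eq_bigr => j _; rewrite !rmorphM.
Qed.

Lemma heis0 h n : heis G h n 0 = 0.
Proof. by case: n => [[|n]|n]; rewrite /heis linear0. Qed.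

Lemma heisZ h n a v : heis G h n (a *: v) = a *: heis G h n v.
Proof. by case: n => [[|n]|n]; rewrite /heis linearZ. Qed.

Lemma heis_sum (A : finType) (c : A -> C) (h : A -> I -> C) n v :
  heis G (fun p => \sum_a c a * h a p) n v = \sum_a c a *: heis G (h a) n v.
Proof.
case: n => [[|n]|n] /=; last exact: creation_sum.
  rewrite -(diag_sum c (fun a (b : lattice I) => cform G (h a) (complexify C b))).
  by congr (lext _ v); apply: funext => b; rewrite cform_suml.
rewrite -annihilation_sum; congr (annihilation _ _ _); apply: funext => i.
by rewrite cform_suml mulr_sumr; apply: eq_bigr => a _; rewrite mulrCA.
Qed.

Lemma heis_zero n v : heis G (fun=> 0) n v = 0.
Proof.
have -> : (fun=> 0) = (fun p : I => \sum_(a in 'I_0) (fun=> 0) a * (fun=> 0 : C) p).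
  by apply: funext => p; rewrite big1 // => a _; rewrite mul0r.
rewrite (heis_sum (fun=> 0) (fun=> fun=> 0)).
by rewrite big1 // => a _; rewrite scale0r.
Qed.

Lemma heis_basis h n v :
  heis G h n v = \sum_i h i *: heis G (basis_vec C i) n v.
Proof. by rewrite -heis_sum; congr (heis G _ n v); apply/funext/basis_vecE. Qed.

Definition first_oscillator (i : I) : latVOA C I :=
  bas C ([mset (i, 0%N)]%mset, 0).

Lemma heis_iota h n a : 0 <= n ->
  heis G h n (iota_e C a) =
  (if n == 0 then cform G h (complexify C a) else 0) *: iota_e C a.
Proof.
case: n => // [[|n]] _ /=; first by rewrite /iota_e lext_bas.
rewrite scale0r /iota_e annihilation_bas big1 // => i _.
by rewrite /= mset0E mulr0 scale0r.
Qed.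

Lemma heis_oscillator h n i : 0 <= n ->
  heis G h n (first_oscillator i) =
  (if n == 1 then cform G h (basis_vec C i) else 0) *: lvac C I.
Proof.
rewrite /first_oscillator; case: n => // [[|n]] _ /=.
  by rewrite lext_bas /= complexify0 cform0r !scale0r.
rewrite annihilation_bas (bigD1 i) //= big1 => [|l li]; last first.
  by rewrite msetnE xpair_eqE (negbTE li) mulr0 scale0r.
rewrite addr0 msetnE xpair_eqE eqxx /=.
case: n => [|n] /=; last by rewrite mulr0 !scale0r.
rewrite mul1r mulr1; congr (_ *: bas C (_, _)).
by apply/msetP => x; rewrite !msetE2 msetnE mset0E; case: eqP.
Qed.

(** The vectors on which the corrections e^{Delta_x} and
    exp(\sum_j a_j x^{-j/k} L(j)) are trivial: Delta_x and L(j) are built from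
    the quadratic expressions below, L(j) containing in addition the products
    h(m)h'(n) with m < 0 and n > j. *)
Definition quadratic_vacuum w : Prop :=
  (forall h n, 1 < n -> heis G h n w = 0) /\
  (forall h h' m n, 0 <= m -> 0 <= n -> 0 < m + n ->
     heis G h m (heis G h' n w) = 0).

Lemma quadratic_vacuum_iota a : quadratic_vacuum (iota_e C a).
Proof.
split=> [h n n1|h h' m n m0 n0 mn].
  by rewrite heis_iota ?ifN ?scale0r //; lia.
rewrite (heis_iota h' a n0) heisZ (heis_iota h a m0) scalerA.
by case: eqP => n0'; last (by rewrite mul0r scale0r); rewrite ifN ?mulr0 ?scale0r //; lia.
Qed.

Lemma quadratic_vacuum_oscillator i : quadratic_vacuum (first_oscillator i).
Proof.
split=> [h n n1|h h' m n m0 n0 mn].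
  by rewrite heis_oscillator ?ifN ?scale0r //; lia.
rewrite (heis_oscillator h' i n0) heisZ /lvac (heis_iota h 0 m0) complexify0.
by rewrite cform0r if_same scale0r scaler0.
Qed.

Section VertexOperators.
Variable eps : lattice I -> lattice I -> C.
Hypothesis eps0 : forall b, eps 0 b = 1.

Lemma Yexp_zero q w : Yexp G eps 0 q w = sconst id q w.
Proof.
rewrite /Yexp; set e := lext _.
have ew : e w = w.
  apply: (fock_ind (f := e) (g := idfun)) => -[A p] /=.
  by rewrite /e lext_bas eps0 scale1r add0r.
apply: normal_exp_zero => //.
- by move=> h n; exact: heis0.
- by move=> n v; rewrite complexify0 heis_zero.
- exact: linear0.
by move=> p; rewrite xpow_zero // => b; rewrite complexify0 cform0l.
Qed.

Lemma Ylat_iota a q w : Ylat G eps (iota_e C a) q w = Yexp G eps a q w.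
Proof. by rewrite /Ylat /normal_vop lext_bas /= enum_mset0. Qed.

Lemma Ylat_oscillator i q w : Ylat G eps (first_oscillator i) q w =
  heis_field 1 (heis G) (basis_vec C i) q w.
Proof.
rewrite /Ylat /normal_vop lext_bas /= enum_msetn /= normal_mul_const //.
  by move=> h n; exact: heis0.
exact: Yexp_zero.
Qed.

(** The vector omega is a combination of the b_s(-1)b_t(-1)1, so L(n) is a combination
    of coefficients of the :b_s(x)b_t(x):, whose terms are b_s(m)b_t(p) for m < 0
    and b_t(p)b_s(m) for m >= 0, with m + p = n > 0.  In the first case p > 1; in
    the second either both modes are nonnegative or m > 1. *)
Lemma Ylat_omega_quadratic_vacuum hb n w : quadratic_vacuum w -> 0 < n ->
  vmode (Ylat G eps) (lomega G hb) (n + 1) w = 0.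
Proof.
move=> [w1 w2] n0; rewrite /vmode; set q := - (n + 1) - 1.
pose f : {linear latVOA C I -> latVOA C I} := lext (fun x : monomial I (lattice I) =>
  foldr (fun jm => normal_mul 1 (heis G) jm.2 (basis_vec C jm.1)) (Yexp G eps x.2)
      (x.1 : {mset (I * nat)}%mset) q w).
have quad s t : f (bas C ((s, 0%N) +` ((t, 0%N) +` mset0), 0)%mset) = 0.
  rewrite /f /= lext_bas /=.
  have -> : ((s, 0%N) +` ((t, 0%N) +` mset0) = seq_mset [:: (s, 0%N); (t, 0%N)])%mset.
    by rewrite !mset_cons; congr (_ +` (_ +` _))%mset; apply/msetP => x; rewrite mset0E mset_seqE.
  have : perm_eq (seq_mset [:: (s, 0%N); (t, 0%N)]) [:: (s, 0%N); (t, 0%N)].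
    exact: perm_eq_seq_mset.
  move: (seq_mset _ : seq _) => A pA.
  (* the enumeration of a multiset is known up to order only; for either order
     the operator is :b_x1(x)b_x2(x): *)
  have := perm_size pA; have := perm_mem pA.
  case: A {pA} => [|[x1 y1] [|[x2 y2] []]] // m _.
  have /(_ (x1, y1)) := m; rewrite !inE eqxx !xpair_eqE /= => /esym y10.
  have {m}/(_ (x2, y2)) := m; rewrite !inE eqxx orbT !xpair_eqE /= => /esym y20.
  have -> : y1 = 0%N by case/orP: y10 => /andP[_ /eqP].
  have -> : y2 = 0%N by case/orP: y20 => /andP[_ /eqP].
  rewrite /=; apply: (normal_mul_field0 _ (h2 := basis_vec C x2)).
  - by move=> h m; exact: heis0.
  - move=> r v; rewrite normal_mul_const //; first by move=> h m; exact: heis0.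
    exact: Yexp_zero.
  - by move=> m p m0 mp; rewrite w1 ?heis0 //; lia.
  move=> m p m0 mp; have [p0|p0] := lerP 0 p; first by apply: w2 => //; lia.
  by rewrite w1 ?heis0 //; lia.
rewrite -[LHS]/(f (lomega G hb)) /lomega linearZ_LR linear_sum big1 ?scaler0 // => i _.
rewrite (_ : -1 = Negz 0) // /heis /lvac /iota_e creation_bas !linear_sum big1 // => t _.
rewrite !linearZ_LR /= creation_bas linear_sum big1 ?scaler0 // => s _.
rewrite linearZ_LR quad.
exact: scaler0.
Qed.

End VertexOperators.
End HeisenbergModes.

(** * The vertex operators on V_K *)

Lemma wt_iota (I : finType) (G : I -> I -> int) a :
  wt G (mset0, a) = (Defs.form G a a %/ 2)%Z.
Proof. by rewrite /wt enum_mset0 big_nil add0r. Qed.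

Lemma wt_oscillator (I : finType) (G : I -> I -> int) i :
  wt G ([mset (i, 0%N)]%mset, 0) = 1.
Proof. by rewrite /wt enum_msetn big_seq1 lform0l addr0. Qed.

Lemma quadratic_vacuumZ (C : numClosedFieldType) (I : finType)
    (G : I -> I -> int) (c : C) (w : latVOA C I) :
  quadratic_vacuum G w -> quadratic_vacuum G (c *: w).
Proof.
move=> [w1 w2]; split=> *; first by rewrite heisZ w1 ?scaler0.
by rewrite !heisZ w2 ?scaler0.
Qed.

Section Untwisted.
Variables (C : numClosedFieldType) (d : nat) (G : 'M[int]_d) (k : nat).
Variables (eps : latK d -> latK d -> C) (hK : 'I_d -> 'I_d -> C) (a : nat -> C).
Hypothesis eps0l : forall b, eps 0 b = 1.

Lemma YK0 q w : YK G eps 0 q w = 0.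
Proof. exact: linear0. Qed.

Lemma YKZ (c : C) (v : VK C d) q w : YK G eps (c *: v) q w = c *: YK G eps v q w.
Proof. exact: linearZ_LR. Qed.

Lemma aL0 q : aL G eps hK a q 0 = 0.
Proof.
rewrite /aL; case: ifP => // q0; rewrite /LK.
by rewrite Ylat_omega_quadratic_vacuum ?scaler0 ?oppr_gt0 //; split=> *; rewrite ?heis0.
Qed.

Lemma aL_quadratic_vacuum w q : quadratic_vacuum G w -> aL G eps hK a q w = 0.
Proof.
move=> w0; rewrite /aL; case: ifP => // q0; rewrite /LK.
by rewrite Ylat_omega_quadratic_vacuum ?scaler0 ?oppr_gt0.
Qed.

(** Only k^{-L(0)} x^{(1/k-1)L(0)} survives in E_f(x^{1/k}). *)
Lemma Ybdm_quadratic_vacuum b q w : quadratic_vacuum G (bas C b) ->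
  Ybdm G k eps hK a (bas C b) q w =
  k%:R ^ (- wt G b) *: YK G eps (bas C b) (q - (1 - k%:Z) * wt G b) w.
Proof.
move=> b0; rewrite -YKZ -[in RHS](mul1r (_ * wt G b)).
apply: (@insert_series_at C (VK C d)) => [p v|p]; first exact: YK0.
rewrite /Ef (smul_at (q0 := (1 - k%:Z) * wt G b) (u := k%:R ^ (- wt G b) *: bas C b)).
- rewrite sexp_killed ?aL0 /sconst ?subr_eq0 // => r; first exact: aL0.
  exact/aL_quadratic_vacuum/quadratic_vacuumZ.
- by move=> r; apply: sexp0 => s; exact: aL0.
by move=> r; rewrite /kxL0 lext_bas.
Qed.

Lemma Ybdm_oscillator i q w :
  Ybdm G k eps hK a (first_oscillator C i) q w =
  k%:R^-1 *: heis G (basis_vec C i) (- q - k%:Z) w.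
Proof.
rewrite Ybdm_quadratic_vacuum; last exact: quadratic_vacuum_oscillator.
rewrite wt_oscillator mulr1; congr (_ *: _).
rewrite /YK Ylat_oscillator // /heis_field; congr (heis _ _ _ _); ring.
Qed.

(** Here L(0) has the eigenvalue <b, b>/2. *)
Lemma Ybdm_iota b q w :
  Ybdm G k eps hK a (iota_e C b) q w =
  k%:R ^ (- (Defs.form G b b %/ 2)%Z) *:
    Yexp G eps b (q - (1 - k%:Z) * (Defs.form G b b %/ 2)%Z) w.
Proof.
rewrite /iota_e Ybdm_quadratic_vacuum; last exact: quadratic_vacuum_iota.
by rewrite wt_iota; congr (_ *: _); rewrite /YK (Ylat_iota G).
Qed.

Lemma Yexp_vacuum b : eps b 0 = 1 -> Yexp G eps b 0 (lvac C 'I_d) = iota_e C b.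
Proof.
move=> b0; rewrite /Yexp normal_exp_leading.
- by rewrite lext_bas b0 scale1r addr0.
- by move=> h n; exact: heis0.
- by move=> n n0; rewrite /lvac heis_iota ?ltW // ifN ?scale0r // gt_eqF.
- exact: linear0.
move=> q; rewrite /lvac /iota_e (xpow_bas (q0 := 0)) //.
by rewrite complexify0 cform0r mul0r.
Qed.

End Untwisted.

(** * Tensor factors and Delta_x on V_L *)

Section TensorFactors.
Variables (C : numClosedFieldType) (d : nat) (G : 'M[int]_d).
Variables (k : nat) (k_gt0 : (0 < k)%N) (eta : C).
Local Notation o := (fst_ix k_gt0).

Lemma in_first0 : in_first k_gt0 (0 : latK d) = 0.
Proof. by apply/ffunP => p; rewrite !ffunE if_same. Qed.

Lemma tensor_factor_iota (b : latK d) :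
  tensor_factor k_gt0 0 (iota_e C b) = iota_e C (in_first k_gt0 b).
Proof.
rewrite /tensor_factor /= /factor1 /iota_e lext_bas /= enum_mset0 /=.
by congr (bas C (_, _)); apply/msetP => x; rewrite mset_seqE mset0E.
Qed.

Lemma nu_inv0 : nu_inv (0 : latL d k) = 0.
Proof. by apply/ffunP => p; rewrite !ffunE. Qed.

Lemma tensor_factor_oscillator (j : 'I_k) i :
  tensor_factor k_gt0 j (first_oscillator C i) =
  first_oscillator C (j, i) :> VL C d k.
Proof.
have seq1 (x : 'I_k * 'I_d * nat) : seq_mset [:: x] = [mset x]%mset.
  by apply/msetP => y; rewrite mset_seqE msetnE /= addn0 eq_sym; case: eqP.
have step r : iter r (@nuhat_inv C d k) (factor1 k_gt0 (first_oscillator C i)) =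
    first_oscillator C (iter r (@ordS k) o, i) :> VL C d k.
  elim: r => [|r IH] /=; last first.
    rewrite IH /nuhat_inv /move_factors /first_oscillator lext_bas enum_msetn /=.
    by rewrite seq1 nu_inv0.
  by rewrite /factor1 /first_oscillator lext_bas enum_msetn /= seq1 in_first0.
rewrite /tensor_factor step; congr (first_oscillator C (_, _)).
by apply: val_inj; rewrite /= iter_ordS /= add0n modn_small.
Qed.

Variable (beta : 'I_k * 'I_d -> 'I_k * 'I_d -> C).

(** The series whose logarithms define the c_{mnr} have constant term 1. *)
Lemma cmnr00 r : cmnr k eta 0 0 r = 0.
Proof.
rewrite /cmnr /plog2; case: eqP => _; last by rewrite big_geq ?mulr0.
by rewrite big1 ?mulr0 // => j _; rewrite big_geq.
Qed.

(** For (m, n) = (0, 0), the one case in which the product of modes need not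
    kill w, the coefficient c_{00r} is zero. *)
Lemma Delta_quadratic_vacuum q w : quadratic_vacuum (gramL G (k := k)) w ->
  Delta G eta beta q w = 0.
Proof.
move=> [_ w2]; rewrite /Delta; case: ifP => // q0.
rewrite big1 // => m _; rewrite big1 // => r _; rewrite big1 // => j _.
have [q00|qn0] := eqVneq q 0; last by rewrite w2 ?scaler0 //; have := ltn_ord m; lia.
rewrite q00 in m *; case: m => [[|m]] //= _.
by rewrite cmnr00 scale0r.
Qed.

Lemma sexp_Delta q w : quadratic_vacuum (gramL G (k := k)) w ->
  sexp (Delta G eta beta) q w = sconst id q w.
Proof.
move=> w0; rewrite sexp_killed // => p; last exact: Delta_quadratic_vacuum.
by apply: Delta_quadratic_vacuum; split=> *; rewrite !heis0.
Qed.

End TensorFactors.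

(** * The twisted modes and the vertex operators on V_L^T *)

Section TwistedModes.
Variables (C : numClosedFieldType) (d : nat) (G : 'M[int]_d).
Variables (k : nat) (k_gt0 : (0 < k)%N) (eta : C).
Local Notation o := (fst_ix k_gt0).
Local Notation heisT := (heisT G k_gt0 eta).

Lemma nu_proj_sum (A : finType) (c : A -> C) (h : A -> 'I_k * 'I_d -> C) n p :
  nu_proj eta n (fun p => \sum_a c a * h a p) p =
  \sum_a c a * nu_proj eta n (h a) p.
Proof.
case: p => j i; rewrite /nu_proj; under [RHS]eq_bigr do rewrite mulrCA.
rewrite -mulr_sumr; congr (_ * _).
under [RHS]eq_bigr do rewrite mulr_sumr.
rewrite exchange_big; apply: eq_bigr => r _; rewrite iter_nuh mulr_sumr.
by apply: eq_bigr => a _; rewrite iter_nuh mulrCA.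
Qed.

Lemma heisT0 h n : heisT h n 0 = 0.
Proof. by case: n => [[|n]|n]; rewrite /Defs.heisT linear0. Qed.

Lemma heisT_sum (A : finType) (c : A -> C) (h : A -> 'I_k * 'I_d -> C) n v :
  heisT (fun p => \sum_a c a * h a p) n v = \sum_a c a *: heisT (h a) n v.
Proof.
have cf m g : cform (gramL G (k := k)) (nu_proj eta m (fun p => \sum_a c a * h a p)) g =
    \sum_a c a * cform (gramL G (k := k)) (nu_proj eta m (h a)) g.
  rewrite -cform_suml; apply: eq_cform => // p; exact: nu_proj_sum.
case: n => [[|n]|n] /=.
- rewrite -(diag_sum c (fun a (b : latK d) => cform (gramL G (k := k))
    (nu_proj eta 0 (h a)) (complexify C (in_first k_gt0 b)))).
  by congr (lext _ v); apply: funext => b; rewrite cf.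
- rewrite -annihilation_sum; congr (annihilation _ _ _); apply: funext => i.
  by rewrite cf mulr_sumr; apply: eq_bigr => a _; rewrite mulrCA.
rewrite -creation_sum; congr (creation _ _ _); apply: funext => i.
by rewrite nu_proj_sum mulr_sumr; apply: eq_bigr => a _; rewrite mulrCA.
Qed.

Lemma heisT_zero n v : heisT (fun=> 0) n v = 0.
Proof.
have -> : (fun=> 0) = (fun p : 'I_k * 'I_d => \sum_(a in 'I_0) (fun=> 0) a * (fun=> 0 : C) p).
  by apply: funext => p; rewrite big1 // => a _; rewrite mul0r.
rewrite (heisT_sum (fun=> 0) (fun=> fun=> 0)).
by rewrite big1 // => a _; rewrite scale0r.
Qed.

Lemma heisT_basis h n v :
  heisT h n v = \sum_p h p *: heisT (basis_vec C p) n v.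
Proof. by rewrite -heisT_sum; congr (heisT _ n v); apply/funext/basis_vecE. Qed.

Lemma nu_proj_in_first n (b : latK d) i :
  nu_proj eta n (complexify C (in_first k_gt0 b)) (o, i) = k%:R^-1 * (b i)%:~R.
Proof.
rewrite /nu_proj; congr (_ * _); rewrite (bigD1 o) //= big1 => [|r r0]; last first.
  rewrite iter_nuh /complexify ffunE /= ifN ?mulr0 //.
  apply: contra r0 => /eqP/(congr1 val); rewrite /= iter_ordS /= add0n modn_small //.
  by move=> r0; apply/eqP/val_inj.
by rewrite mulr0 oppr0 expr0z mul1r addr0 /complexify ffunE eqxx.
Qed.

(** The projection of (b, 0, ..., 0) to an eigenspace has first component b/k,
    whatever the eigenvalue, and the variables of the Fock space are scaled so
    as to absorb the factor 1/k. *)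
Lemma heisT_creation_in_first n (b : latK d) v :
  heisT (complexify C (in_first k_gt0 b)) (Negz n) v =
  creation (complexify C b) n v.
Proof.
rewrite /Defs.heisT; congr (creation _ n v); apply: funext => i.
by rewrite nu_proj_in_first mulVKf // pnatr_eq0 -lt0n.
Qed.

Lemma heisT_killed h n (b : latK d) : 0 < n -> heisT h n (bas C (mset0, b)) = 0.
Proof.
case: n => // -[//|n] _; rewrite /= annihilation_bas big1 // => i _.
by rewrite /= mset0E mulr0 scale0r.
Qed.

Lemma nu_invN (b : latL d k) : nu_inv (- b) = - nu_inv b.
Proof. by apply/ffunP => p; rewrite !ffunE. Qed.

Lemma iter_nu_inv0 r : iter r (@nu_inv d k) 0 = 0.
Proof. by elim: r => // r IH; rewrite iterS IH nu_inv0. Qed.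

Lemma iter_nu_invN r (b : latL d k) : iter r (@nu_inv d k) (- b) = - iter r (@nu_inv d k) b.
Proof. by elim: r => // r IH; rewrite !iterS IH nu_invN. Qed.

Lemma iter_nu r (b : latL d k) p : iter r (@nu d k) b p = b (iter r (@ordS k) p.1, p.2).
Proof.
elim: r p => [|r IH] [j i] //; rewrite iterS ffunE IH /=.
by rewrite -iterSr iterS.
Qed.

Lemma form_in_first (b c : latK d) :
  Defs.form (gramL G (k := k)) (in_first k_gt0 b) (in_first k_gt0 c) = Defs.form G b c.
Proof.
rewrite /Defs.form.
rewrite sum_pair.
rewrite (bigD1 o) //= [X in _ + X]big1 ?addr0 => [|j j0]; last first.
  rewrite big1 // => i _; rewrite big1 // => q _.
  by rewrite ffunE /= (negbTE j0) !mul0r.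
apply: eq_bigr => i _; rewrite sum_pair
  (bigD1 o) //= [X in _ + X]big1 ?addr0 => [|j j0]; last first.
  rewrite big1 // => l _.
  by rewrite [in_first k_gt0 c _]ffunE /= (negbTE j0) mulr0 mul0r.
by apply: eq_bigr => l _; rewrite !ffunE /gramL /= ?eqxx.
Qed.

(** A nontrivial rotation moves (b, 0, ..., 0) to another, orthogonal, factor. *)
Lemma form_nu_in_first r (b c : latK d) : (0 < r < k)%N ->
  Defs.form (gramL G (k := k)) (iter r (@nu d k) (in_first k_gt0 b)) (in_first k_gt0 c) = 0.
Proof.
move=> rk; rewrite /Defs.form big1 // => -[j i] _; rewrite big1 // => -[l m] _.
rewrite iter_nu !ffunE /gramL /=.
case: (eqVneq l o) => [->|]; last by rewrite mulr0 mul0r.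
case: (eqVneq j o) => [->|]; last by rewrite mulr0.
rewrite ifN ?mul0r //; apply/eqP => /(congr1 val); rewrite /= iter_ordS /=.
by rewrite add0n modn_small; lia.
Qed.

Lemma sigma_in_first (b : latK d) : sigma G eta (in_first k_gt0 b) = 1.
Proof.
rewrite /sigma big_nat_cond big1 => [|j /andP[jk _]]; last first.
  by rewrite form_nu_in_first.
case: ifP => k_odd; rewrite ?mulr1 // mul1r form_nu_in_first //.
by case: (k) k_gt0 k_odd => [|[|n]] //= _ _; lia.
Qed.

Lemma coset_rep_in_first (b : latK d) : coset_rep (in_first k_gt0 b) = b.
Proof.
apply/ffunP => i; rewrite /coset_rep sum_ffunE (bigD1 o) //= big1 => [|j j0].
  by rewrite !ffunE eqxx addr0.
by rewrite !ffunE (negbTE j0).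
Qed.

Section Cocycle.
Variables (eps : latK d -> latK d -> C) (tau : hatL C d k -> C).
Hypothesis eps_ext : is_extension G (eta0 k eta) eps.
Hypothesis eta_neq0 : eta != 0.
Hypothesis tauP : is_tau G eta eps tau.
Local Notation eps_nu := (@Defs.eps_nu C d G k eta eps).
Local Notation coset_coef := (coset_coef G k_gt0 eta eps tau).
Local Notation hat_act := (hat_act G k_gt0 eta eps tau).
Local Notation utens := (utens G k_gt0 eta eps tau).

Let component0 j : component (0 : latL d k) j = 0.
Proof. by apply/ffunP => i; rewrite !ffunE. Qed.

Lemma eps_nu0l b : eps_nu 0 b = 1.
Proof.
have [_ eps1 _ _] := eps_ext; rewrite /Defs.eps_nu /epsL big1 => [|j _].
  by rewrite mul1r big1 // => j _; rewrite iter_nu_inv0 lform0l.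
by rewrite component0 (eps1 _).1.
Qed.

Lemma eps_nu0r b : eps_nu b 0 = 1.
Proof.
have [_ eps1 _ _] := eps_ext; rewrite /Defs.eps_nu /epsL big1 => [|j _].
  by rewrite mul1r big1 // => j _; rewrite lform0r.
by rewrite component0 (eps1 _).2.
Qed.

(** Left and right inverses agree in the twisted extension: for the cocycle of
    K-hat this is the cocycle identity at (c, -c, c), and the remaining factor
    is bimultiplicative. *)
Lemma eps_nuN b : eps_nu (- b) b = eps_nu b (- b).
Proof.
have [_ eps1 epsA _] := eps_ext; rewrite /Defs.eps_nu; congr (_ * _).
  apply: eq_bigr => j _.
  have -> : component (- b) j = - component b j by apply/ffunP => i; rewrite !ffunE.
  have := epsA (component b j) (- component b j) (component b j).
  by rewrite subrr addNr (eps1 _).1 (eps1 _).2 !mulr1.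
by apply: eq_bigr => j _; rewrite iter_nu_invN lformNl lformNr.
Qed.

Lemma eps_nu_neq0 b c : eps_nu b c != 0.
Proof.
have [epsn _ _ _] := eps_ext; rewrite /Defs.eps_nu mulf_neq0 //; apply: (big_ind (fun z => z != 0)) => [||j _].
- exact: oner_neq0.
- by move=> x y; exact: mulf_neq0.
- have [n ->] := epsn (component b j) (component c j).
  by rewrite expf_neq0 // mulf_neq0 // expf_neq0 // oppr_eq0 oner_eq0.
- exact: oner_neq0.
- by move=> x y; exact: mulf_neq0.
by rewrite expfz_neq0 // oppr_eq0 expf_neq0.
Qed.

(** tau is a homomorphism with nonzero values, and (1, 0) is idempotent. *)
Lemma tau_one : tau (1, 0) = 1.
Proof.
have [tau0 tauM _ _] := tauP.
have N1 : in_Nhat G eta ((1, 0) : hatL C d k).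
  split; first by exists 0%N.
  by move=> h _; rewrite complexify0 cform0l.
have := tauM _ _ N1 N1; rewrite /hmul /= addr0 eps_nu0l !mulr1 => t2.
by apply: (mulfI (tau0 _ N1)); rewrite -t2 mulr1.
Qed.

Lemma coset_coef_in_first b : coset_coef (1, in_first k_gt0 b) = 1.
Proof.
rewrite /Defs.coset_coef /= coset_rep_in_first /hmul /hinv /= addNr eps_nuN.
by rewrite mul1r mulr1 mulVf ?eps_nu_neq0 // tau_one.
Qed.

Lemma utens_in_first b : utens (1, in_first k_gt0 b) = bas C (mset0, b).
Proof. by rewrite /Defs.utens coset_coef_in_first scale1r coset_rep_in_first. Qed.

Lemma vacTE : vacT G k_gt0 eta eps tau = bas C (mset0, 0).
Proof. by rewrite /vacT -(in_first0 d k_gt0) utens_in_first. Qed.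

Lemma hat_act_vacuum b :
  hat_act (1, in_first k_gt0 b) (bas C (mset0, 0)) = bas C (mset0, b).
Proof.
rewrite /Defs.hat_act lext_bas /= /hmul /= in_first0 addr0 eps_nu0r !mulr1.
by rewrite coset_coef_in_first scale1r coset_rep_in_first.
Qed.

Lemma hat_act1 w : hat_act (1, 0) w = w.
Proof.
apply: (fock_ind (f := lext _) (g := idfun)) => -[A b] /=.
rewrite lext_bas /= /hmul /= add0r eps_nu0l !mulr1.
by rewrite coset_coef_in_first scale1r coset_rep_in_first.
Qed.

Hypothesis eta_prim : k.-primitive_root eta.

Lemma YTexp_zero q w : YTexp G k_gt0 eta eps tau 0 q w = sconst id q w.
Proof.
rewrite /YTexp /sscale lform0l -[X in sigma _ _ X](in_first0 d k_gt0) sigma_in_first.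
rewrite expr0z mulr1 scale1r complexify0.
have nu0 p : nu_proj eta 0 (fun=> 0 : C) p = 0 :> C.
  case: p => j i; rewrite /nu_proj big1 ?mulr0 // => r _.
  by rewrite iter_nuh mulr0.
rewrite normal_exp_zero //.
- by move=> h n; exact: heisT0.
- by move=> n v; exact: heisT_zero.
- exact: linear0.
- exact: hat_act1.
move=> p; apply: xpow_zero => // b.
have -> : nu_proj eta 0 (fun=> 0 : C) = (fun=> 0 : C) :> ('I_k * 'I_d -> C) by exact/funext.
by rewrite !cform0l mul0r subr0 addr0.
Qed.

Lemma Wop_iota b q w :
  Wop G k_gt0 eta eps tau (iota_e C b) q w = YTexp G k_gt0 eta eps tau b q w.
Proof. by rewrite /Wop /normal_vop lext_bas /= enum_mset0. Qed.

Lemma Wop_oscillator p q w :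
  Wop G k_gt0 eta eps tau (first_oscillator C p) q w = heisT (basis_vec C p) (- q - k%:Z) w.
Proof.
rewrite /Wop /normal_vop lext_bas /= enum_msetn /= normal_mul_const //.
  by move=> h n; exact: heisT0.
exact: YTexp_zero.
Qed.

(** As e^{Delta_x} fixes such a v, Y(v,x) is the uncorrected operator W(v,x). *)
Lemma YT_quadratic_vacuum beta v q w : quadratic_vacuum (gramL G (k := k)) v ->
  YT G k_gt0 eta eps tau beta v q w = Wop G k_gt0 eta eps tau v q w.
Proof.
move=> v0; rewrite /YT (@insert_series_at C _ (VL C d k) _ _ _ v v 0) ?mulr0 ?subr0 //.
  by move=> r u; exact: linear0.
by move=> p; exact: sexp_Delta.
Qed.

Lemma nu_proj0_in_first (b : latK d) p :
  nu_proj eta 0 (complexify C (in_first k_gt0 b)) p = k%:R^-1 * (b p.2)%:~R.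
Proof.
by case: p => j i; rewrite (nu_proj_first k_gt0 eta_prim) mul0r expr0z mul1r nu_proj_in_first.
Qed.

(** The projection (b/k, ..., b/k) of (b, 0, ..., 0) has norm k <b,b>/k^2. *)
Lemma cform_nu_proj0 (b : latK d) :
  cform (gramL G (k := k)) (nu_proj eta 0 (complexify C (in_first k_gt0 b)))
    (nu_proj eta 0 (complexify C (in_first k_gt0 b))) =
  k%:R^-1 * (Defs.form G b b)%:~R.
Proof.
have kn0 : k%:R != 0 :> C by rewrite pnatr_eq0 -lt0n.
rewrite -cform_complexify (eq_cform _ (nu_proj0_in_first b) (nu_proj0_in_first b)).
rewrite /cform.
pose g i l : C := (b i)%:~R * (b l)%:~R * (G i l)%:~R.
rewrite sum_pair.
transitivity (\sum_(j < k) k%:R^-1 ^+ 2 * \sum_i \sum_l g i l); last first.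
  rewrite sumr_const card_ord -[RHS]/(_ * \sum_i \sum_l g i l) -mulrnAl.
  by congr (_ * _); rewrite -mulr_natr; field.
apply: eq_bigr => j _; rewrite mulr_sumr; apply: eq_bigr => i _.
rewrite sum_pair (bigD1 j) //=.
rewrite [X in _ + X]big1 ?addr0 => [|r rj]; last first.
  by rewrite big1 // => l _; rewrite /gramL /= eq_sym (negbTE rj) mulr0.
rewrite mulr_sumr; apply: eq_bigr => l _.
by rewrite /g /gramL eqxx /=; ring.
Qed.

(** The exponent of x on the vacuum is <b_(0),b_(0)>/2 - <b,b>/2 =
    (1/k-1) <b,b>/2, and sigma is 1 because (b, 0, ..., 0) is orthogonal to its
    nontrivial rotations. *)
Lemma YTexp_leading (b : latK d) : (2 %| Defs.form G b b)%Z ->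
  YTexp G k_gt0 eta eps tau (in_first k_gt0 b)
    ((1 - k%:Z) * (Defs.form G b b %/ 2)%Z) (bas C (mset0, 0)) =
  k%:R ^ (- (Defs.form G b b %/ 2)%Z) *: bas C (mset0, b).
Proof.
move=> even; have kn0 : k%:R != 0 :> C by rewrite pnatr_eq0 -lt0n.
rewrite /YTexp /sscale sigma_in_first form_in_first mulr1; congr (_ *: _).
rewrite normal_exp_leading.
- exact: hat_act_vacuum.
- by move=> h n; exact: heisT0.
- by move=> n n0; rewrite heisT_killed.
- exact: linear0.
apply: xpow_bas => //=.
rewrite in_first0 complexify0 cform0r cform_nu_proj0 cform_complexify form_in_first.
have -> : (Defs.form G b b)%:~R = (Defs.form G b b %/ 2)%Z%:~R * 2 :> C.
  by rewrite -{1}(divzK even) intrM.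
by rewrite intrM rmorphB /=; field.
Qed.

End Cocycle.
End TwistedModes.

(** * The isomorphism *)

Section Isomorphism.
Variables (C : numClosedFieldType) (d : nat) (G : 'M[int]_d).
Variables (k : nat) (k_gt0 : (0 < k)%N) (eta : C).
Variables (eps : latK d -> latK d -> C) (tau : hatL C d k -> C).
Local Notation heisT := (heisT G k_gt0 eta).

Definition intertwines_first_factor (f : VLT C d -> VK C d) : Prop :=
  forall (b : latK d) m v, f (heisT (complexify C (in_first k_gt0 b)) m v) =
    k%:R^-1 *: heis G (complexify C b) m (f v).

Lemma transports_fields_intertwines f :
  transports_fields G k_gt0 eta f -> intertwines_first_factor f.
Proof.
move=> [f' [f'f _ tf]] b m v.
have := tf b (- m - k%:Z) (f v).
rewrite /conjugate_series f'f /fieldT /fieldK /sscale /sshift /heis_field.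
rewrite (_ : - (- m - k%:Z) - k%:Z = m); last by ring.
by rewrite (_ : - (- m - k%:Z - (1 - k%:Z)) - 1%:Z = m) //; ring.
Qed.

(** The variables X_(i,n) act as the creation modes of (b_i, 0, ..., 0), so f is
    determined on monomials by induction on their degree. *)
Lemma intertwiner_unique (f g : {linear VLT C d -> VK C d}) :
  intertwines_first_factor f -> intertwines_first_factor g ->
  (forall b : latK d, f (bas C (mset0, b)) = g (bas C (mset0, b))) -> f =1 g.
Proof.
move=> If Ig fg; apply: (fock_ind (f := f) (g := g)) => -[A b].
rewrite -(seq_mset_id A); elim: (enum_mset A) => [|[i n] s IH].
  have -> : seq_mset [::] = mset0 :> {mset ('I_d * nat)%type}%mset.
    by apply/msetP => x; rewrite mset_seqE mset0E.
  exact: fg.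
pose e : latK d := [ffun j => (i == j)%:Z].
have -> : bas C (seq_mset ((i, n) :: s), b) =
    heisT (complexify C (in_first k_gt0 e)) (Negz n) (bas C (seq_mset s, b)).
  rewrite heisT_creation_in_first creation_bas (bigD1 i) //= big1 => [|j ji].
    by rewrite addr0 mset_cons /complexify ffunE eqxx scale1r.
  by rewrite /complexify ffunE eq_sym (negbTE ji) scale0r.
by rewrite If Ig IH.
Qed.

Variables (hK : 'I_d -> 'I_d -> C) (hL : 'I_k * 'I_d -> 'I_k * 'I_d -> C).
Variables (a : nat -> C) (Yhn : VL C d k -> series (VK C d)).
Variable F : {linear VLT C d -> VK C d}.
Hypothesis even_form : forall b : latK d, (2 %| Defs.form G b b)%Z.
Hypothesis eta_prim : k.-primitive_root eta.
Hypothesis eps_ext : is_extension G (eta0 k eta) eps.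
Hypothesis tauP : is_tau G eta eps tau.
Hypothesis YhnP : bdm_on_factors G k_gt0 eta eps hK a Yhn.
Hypothesis Fhom : twisted_hom (YT G k_gt0 eta eps tau hL) Yhn F.
Hypothesis Fvac : F (vacT G k_gt0 eta eps tau) = lvac C 'I_d.

Let eta_neq0 : eta != 0.
Proof. by rewrite (prim_root_eq0 eta_prim) -lt0n. Qed.

Let eps0l b : eps 0 b = 1.
Proof. by have [_ eps1 _ _] := eps_ext; rewrite (eps1 b).1. Qed.

(** It suffices to treat the basis vectors (j, i) of h, where the relation is
    that of F with the vertex operators of b_i(-1)1 in the factor j.  The
    substitution x^{1/k} -> eta^j x^{1/k} contributes eta^{jq} to the
    coefficient of x^{q/k}, where q = -m-k, and eta^{-jk} = 1. *)
Lemma F_heisT (h : 'I_k * 'I_d -> C) m v :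
  F (heisT h m v) = k%:R^-1 *:
    \sum_(j < k) eta ^ (- (j%:Z * m)) *: heis G (fun i => h (j, i)) m (F v).
Proof.
have basis j i : F (heisT (basis_vec C (j, i)) m v) =
    (k%:R^-1 * eta ^ (- (j%:Z * m))) *: heis G (basis_vec C i) m (F v).
  have := Fhom (first_oscillator C (j, i)) (- m - k%:Z) v.
  rewrite YT_quadratic_vacuum; last exact: quadratic_vacuum_oscillator.
  rewrite (Wop_oscillator _ eps_ext eta_neq0 tauP).
  rewrite (_ : - (- m - k%:Z) - k%:Z = m); last by ring.
  move=> ->; rewrite -tensor_factor_oscillator YhnP // /ssubst.
  rewrite Ybdm_oscillator // (_ : - (- m - k%:Z) - k%:Z = m); last by ring.
  rewrite scalerA mulrC; congr ((_ * _) *: _).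
  have eta_jk : eta ^ (j%:Z * k%:Z) = 1.
    by rewrite mulrC -exprz_exp (prim_expr_order eta_prim : eta ^ k%:Z = 1) exp1rz.
  have -> : - (j%:Z * m) = j%:Z * (- m - k%:Z) + j%:Z * k%:Z by ring.
  by rewrite [RHS]expfzDr // eta_jk mulr1 exprnP exprz_exp.
rewrite heisT_basis linear_sum sum_pair scaler_sumr; apply: eq_bigr => j _.
rewrite heis_basis !scaler_sumr; apply: eq_bigr => i _.
by rewrite linearZ_LR basis !scalerA; congr (_ *: _); ring.
Qed.

Lemma F_intertwines : intertwines_first_factor F.
Proof.
move=> b m v; rewrite F_heisT; congr (_ *: _).
rewrite (bigD1 (fst_ix k_gt0)) //= big1 ?addr0 => [|j j0].
  rewrite mul0r oppr0 expr0z scale1r; congr (heis G _ m _).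
  by apply: funext => i; rewrite /complexify ffunE eqxx.
rewrite (_ : (fun i => _) = fun=> 0) ?heis_zero ?scaler0 //.
by apply: funext => i; rewrite /complexify ffunE (negbTE j0).
Qed.

(** Compare the coefficients of x^{(1/k-1)<b,b>/2} in the images of the vacuum
    vectors under the operators of iota(e_b)^1; the common factor
    k^{-<b,b>/2} is not zero. *)
Lemma F_group_algebra (b : latK d) : F (bas C (mset0, b)) = iota_e C b.
Proof.
have kn0 : k%:R ^ (- (Defs.form G b b %/ 2)%Z) != 0 :> C.
  by rewrite expfz_neq0 // pnatr_eq0 -lt0n.
have [_ eps1 _ _] := eps_ext.
have := Fhom (iota_e C (in_first k_gt0 b))
  ((1 - k%:Z) * (Defs.form G b b %/ 2)%Z) (vacT G k_gt0 eta eps tau).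
rewrite YT_quadratic_vacuum; last exact: quadratic_vacuum_iota.
rewrite Fvac (vacTE _ eps_ext eta_neq0 tauP) Wop_iota.
rewrite (YTexp_leading k_gt0 eps_ext eta_neq0 tauP eta_prim) //.
rewrite -tensor_factor_iota YhnP // /ssubst expr0 exp1rz scale1r.
rewrite Ybdm_iota // subrr Yexp_vacuum ?(eps1 _).2 // linearZ_LR.
exact: (scalerI kn0).
Qed.

End Isomorphism.

Theorem theorem5p1 (R : realType)
    (* the lattices K and L = K^k *)
    (d : nat) (G : 'M[int]_d) (k : nat) (k_gt0 : (0 < k)%N)
    (* the root of unity, the cocycle of K-hat, and the character of N-hat *)
    (eta : R[i]) (eps : latK d -> latK d -> R[i]) (tau : hatL R[i] d k -> R[i])
    (* orthonormal bases of C \otimes K and C \otimes L *)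
    (hK : 'I_d -> 'I_d -> R[i]) (hL : 'I_k * 'I_d -> 'I_k * 'I_d -> R[i])
    (a : nat -> R[i])
    (Yhn : VL R[i] d k -> series (VK R[i] d))
    (F : {linear VLT R[i] d -> VK R[i] d}) (Finv : VK R[i] d -> VLT R[i] d) :
  even_posdef_lattice G ->
  k.-primitive_root eta ->
  is_extension G (eta0 k eta) eps ->
  is_tau G eta eps tau ->
  orthonormal_basis G hK ->
  orthonormal_basis (gramL G (k := k)) hL ->
  is_bdm_coeffs k a ->
  (* (V_K, Y_nuhat) *)
  twisted_module (YL G eps) (lvac R[i] ('I_k * 'I_d)%type)
    (lomega (gramL G (k := k)) hL) (k * d)%:R (nuhat (k := k)) k eta Yhn ->
  bdm_on_factors G k_gt0 eta eps hK a Yhn ->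
  (* F is the normalized isomorphism *)
  cancel F Finv -> cancel Finv F ->
  twisted_hom (YT G k_gt0 eta eps tau hL) Yhn F ->
  F (vacT G k_gt0 eta eps tau) = lvac R[i] 'I_d ->
  [/\ transports_fields G k_gt0 eta F /\
      transports_group_algebra G k_gt0 eta eps tau F,
      forall F' : {linear VLT R[i] d -> VK R[i] d},
        transports_fields G k_gt0 eta F' ->
        transports_group_algebra G k_gt0 eta eps tau F' ->
        forall v, F' v = F v
    & forall (al : latL d k) (q : int) (w : VK R[i] d),
        conjugate_series F Finv (fieldT G k_gt0 eta al) q w =
        sscale k%:R^-1 (sshift (1 - k%:Z)
          (fun p u => \sum_(j < k) eta ^+ j *:
             ssubst (eta ^+ j) (fieldK G (component al j)) p u)) q w].
Proof.
move=> [_ even_form _] eta_prim eps_ext tauP _ _ _ _ YhnP FK FinvK Fhom Fvac.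
have eta_neq0 : eta != 0 by rewrite (prim_root_eq0 eta_prim) -lt0n.
have Fh := F_heisT eta_prim eps_ext tauP YhnP Fhom.
have If := F_intertwines eta_prim eps_ext tauP YhnP Fhom.
have Fga := F_group_algebra even_form eta_prim eps_ext tauP YhnP Fhom Fvac.
split; first split.
- exists Finv; split=> // b q w.
  rewrite /conjugate_series /fieldT /heis_field If FinvK /sscale /sshift /fieldK.
  by rewrite /heis_field; congr (_ *: heis _ _ _ _); ring.
- by move=> b; rewrite utens_in_first.
- move=> F' /transports_fields_intertwines If' ga'.
  apply: (intertwiner_unique If' If) => b.
  by rewrite Fga -(utens_in_first k_gt0 eps_ext eta_neq0 tauP) ga'.
move=> al q w; rewrite /conjugate_series /fieldT /heis_field Fh FinvK /sscale /sshift.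
congr (_ *: _); apply: eq_bigr => j _; rewrite /ssubst scalerA; congr (_ *: _).
  rewrite exprnP exprz_exp -expfzDr //.
  have -> : j%:Z + j%:Z * (q - (1 - k%:Z)) = - (j%:Z * (- q - k%:Z)) by ring.
  done.
rewrite /fieldK /heis_field.
have -> : - (q - (1 - k%:Z)) - 1%:Z = - q - k%:Z by ring.
by congr (heis _ _ _ _); apply: funext => i; rewrite /complexify ffunE.
Qed.
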